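(* Let $k$ be a finite field and $n>0$ an integer. Then $$H^*(GL_n(k),k)\simeq \mathrm{Ext}^*_{\mathcal F_n}(\Lambda^n,\Lambda^n).$$
   Context: $\mathcal F_n$ is the abelian category of all functors from the category $\mathrm{Vect}_{\le n}$ of $k$-vector spaces of dimension $\le n$ (with $k$-linear maps as morphisms) to the category of finite dimensional $k$-vector spaces. (Functors are not required to be additive or linear.) $\Lambda^n\in\mathcal F_n$ is the $n$-th exterior power functor $V\mapsto\Lambda^n(V)$. $H^*(GL_n(k),k)$ is the group cohomology of the finite group $GL_n(k)$ with coefficients in the trivial module $k$. *)

(* Defs.v *)
From HB Require Import structures.
From mathcomp Require Import all_boot all_order all_fingroup all_algebra all_field.
From mathcomp Require Import boolp zify.

Set Implicit Arguments.
Unset Strict Implicit.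
Unset Printing Implicit Defensive.

Import GRing.Theory.
Local Open Scope ring_scope.

Section QuotientModule.
Variables (R : pzRingType) (V : lmodType R) (S : submodClosed V).
Local Open Scope quotient_scope.

Lemma submodClosed_zmod_closed : zmod_closed (S : {pred V}).
Proof.
split=> [|x y xS yS]; first exact: rpred0.
by rewrite rpredD // -scaleN1r rpredZ.
Qed.

Definition submodClosed_zmod : zmodClosed V :=
  HB.pack (S : {pred V})
    (GRing.isZmodClosed.Build V (S : {pred V}) submodClosed_zmod_closed).

Definition lmod_quot : Type := Quotient.quot submodClosed_zmod.

HB.instance Definition _ := Choice.on lmod_quot.
HB.instance Definition _ := GRing.Zmodule.on lmod_quot.

Definition lmod_quot_pi (x : V) : lmod_quot := \pi_(Quotient.quot submodClosed_zmod) x.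

Lemma lmod_quot_piD x y : lmod_quot_pi (x + y) = lmod_quot_pi x + lmod_quot_pi y.
Proof. exact: Quotient.pi_add. Qed.

Lemma lmod_quot_pi_eq x y : (lmod_quot_pi x == lmod_quot_pi y) = (x - y \in S).
Proof. by rewrite -(Quotient.idealrBE submodClosed_zmod). Qed.

Lemma lmod_quot_pi_surj (q : lmod_quot) : exists x, lmod_quot_pi x = q.
Proof. by exists (generic_quotient.repr (q : Quotient.quot submodClosed_zmod)); rewrite /lmod_quot_pi reprK. Qed.

Lemma lmod_quot_pi_surjb (q : lmod_quot) : exists x, lmod_quot_pi x == q.
Proof. by have [x <-] := lmod_quot_pi_surj q; exists x. Qed.

Definition lmod_quot_scale (a : R) (q : lmod_quot) : lmod_quot :=
  lmod_quot_pi (a *: generic_quotient.repr (q : Quotient.quot submodClosed_zmod)).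

Lemma lmod_quot_scaleE a x :
  lmod_quot_scale a (lmod_quot_pi x) = lmod_quot_pi (a *: x).
Proof.
apply/eqP; rewrite lmod_quot_pi_eq -scalerBr rpredZ //.
by rewrite -lmod_quot_pi_eq /lmod_quot_pi reprK.
Qed.

Lemma lmod_quot_scaleA a b q :
  lmod_quot_scale a (lmod_quot_scale b q) = lmod_quot_scale (a * b) q.
Proof.
by have [x <-] := lmod_quot_pi_surj q; rewrite !lmod_quot_scaleE scalerA.
Qed.

Lemma lmod_quot_scale1 : left_id 1 lmod_quot_scale.
Proof.
by move=> q; have [x <-] := lmod_quot_pi_surj q; rewrite lmod_quot_scaleE scale1r.
Qed.

Lemma lmod_quot_scaleDr : right_distributive lmod_quot_scale +%R.
Proof.
move=> a p q; have [x <-] := lmod_quot_pi_surj p.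
have [y <-] := lmod_quot_pi_surj q.
by rewrite -lmod_quot_piD !lmod_quot_scaleE scalerDr lmod_quot_piD.
Qed.

Lemma lmod_quot_scaleDl q : {morph lmod_quot_scale^~ q : a b / a + b}.
Proof.
move=> a b; have [x <-] := lmod_quot_pi_surj q.
by rewrite !lmod_quot_scaleE scalerDl lmod_quot_piD.
Qed.

HB.instance Definition _ := GRing.Zmodule_isLmodule.Build R lmod_quot
  lmod_quot_scaleA lmod_quot_scale1 lmod_quot_scaleDr lmod_quot_scaleDl.

Lemma lmod_quot_pi_linear : linear lmod_quot_pi.
Proof. by move=> a x y; rewrite lmod_quot_piD -lmod_quot_scaleE. Qed.

HB.instance Definition _ :=
  GRing.isLinear.Build R V lmod_quot _ lmod_quot_pi lmod_quot_pi_linear.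

End QuotientModule.

Section QuotientVectorSpace.
Variables (K : fieldType) (W : vectType K) (U : {vspace W}).

Definition vect_quot : Type := lmod_quot U.
HB.instance Definition _ := GRing.Lmodule.on vect_quot.

Definition vect_quot_pi : W -> vect_quot := @lmod_quot_pi K W U.
HB.instance Definition _ := GRing.Linear.on vect_quot_pi.

Lemma vect_quot_pi_eq x y : (vect_quot_pi x == vect_quot_pi y) = (x - y \in U).
Proof. exact: lmod_quot_pi_eq. Qed.

Lemma vect_quot_pi_surj (q : vect_quot) : exists x, vect_quot_pi x = q.
Proof. exact: lmod_quot_pi_surj. Qed.

Fact vect_quot_iso : Vector.axiom (\dim U^C) vect_quot.
Proof.
pose h (w : subvs_of U^C) := vect_quot_pi (vsval w).
have hlin : linear h by move=> a x y; rewrite /h !linearP.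
have hinj : injective h.
  move=> x y /eqP; rewrite vect_quot_pi_eq => Uxy; apply/val_inj/eqP.
  rewrite -subr_eq0 -memv0 -(capv_compl U) memv_cap Uxy.
  by rewrite rpredB ?subvsP.
have hsurj q : exists w, h w == q.
  have [x <-] := vect_quot_pi_surj q.
  have := memvf x; rewrite -(addv_complf U) => /memv_addP[u Uu [w Cw ->]].
  exists (Subvs Cw); rewrite /h /= vect_quot_pi_eq opprD addrCA subrr addr0.
  by rewrite rpredN.
pose g q := xchoose (hsurj q).
have hK q : h (g q) = q by apply/eqP/(xchooseP (hsurj q)).
have gK : cancel h g by move=> w; apply: hinj; rewrite hK.
have [f flin fbij] := subvs_vect_iso U^C; exists (f \o g).
  move=> a x y /=; rewrite -flin; congr (f _).
  by apply: hinj; rewrite hlin !hK.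
by apply: bij_comp fbij _; exists h.
Qed.

HB.instance Definition _ := Lmodule_hasFinDim.Build K vect_quot vect_quot_iso.
End QuotientVectorSpace.

Section QuotientMap.
Variables (K : fieldType) (W W' : vectType K) (U : {vspace W}) (U' : {vspace W'}).
Variables (g : 'Hom(W, W')) (gU : (g @: U <= U')%VS).

Definition vect_quot_map_fun (q : vect_quot U) : vect_quot U' :=
  vect_quot_pi U' (g (xchoose (lmod_quot_pi_surjb q))).

Lemma vect_quot_map_funE x :
  vect_quot_map_fun (vect_quot_pi U x) = vect_quot_pi U' (g x).
Proof.
apply/eqP; rewrite vect_quot_pi_eq -linearB (subvP gU) // memv_img //.
by rewrite -vect_quot_pi_eq; apply: (xchooseP (lmod_quot_pi_surjb _)).
Qed.

Lemma vect_quot_map_linear : linear vect_quot_map_fun.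
Proof.
move=> a p q; have [x <-] := vect_quot_pi_surj p.
have [y <-] := vect_quot_pi_surj q.
by rewrite -linearP !vect_quot_map_funE -linearP -linearP.
Qed.
HB.instance Definition _ :=
  GRing.isLinear.Build K (vect_quot U) (vect_quot U') _ vect_quot_map_fun
    vect_quot_map_linear.

Definition vect_quot_map : 'Hom(vect_quot U, vect_quot U') := linfun vect_quot_map_fun.

Lemma vect_quot_mapE x : vect_quot_map (vect_quot_pi U x) = vect_quot_pi U' (g x).
Proof. by rewrite lfunE /= vect_quot_map_funE. Qed.
End QuotientMap.

Record cochain_complex (K : fieldType) := CochainComplex {
  cochain :> nat -> lmodType K;
  codiff : forall i, {linear cochain i -> cochain i.+1};
  codiffK : forall i x, codiff i.+1 (codiff i x) = 0
}.

Section Cohomology.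
Variables (K : fieldType) (C : cochain_complex K) (i : nat).

Definition is_cocycle : pred (C i) := fun x => codiff C i x == 0.

Lemma is_cocycle_submod_closed : submod_closed is_cocycle.
Proof.
split=> [|a x y]; rewrite !unfold_in ?linear0 //.
by move=> /eqP xZ /eqP yZ; rewrite linearP xZ yZ scaler0 addr0.
Qed.
HB.instance Definition _ :=
  GRing.isSubmodClosed.Build K (C i) is_cocycle is_cocycle_submod_closed.

Record cocycles : Type := Cocycle { cocycle_val : C i; _ : is_cocycle cocycle_val }.
HB.instance Definition _ := [isSub for cocycle_val].
HB.instance Definition _ := [Choice of cocycles by <:].
HB.instance Definition _ := [SubChoice_isSubLmodule of cocycles by <:].

End Cohomology.

Definition is_coboundary (K : fieldType) (C : cochain_complex K) (i : nat) :
    C i -> Prop :=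
  match i with
  | 0 => fun x => x = 0
  | j.+1 => fun x => exists y : C j, x = codiff C j y
  end.

Section CohomologyQuotient.
Variables (K : fieldType) (C : cochain_complex K) (i : nat).

Definition coboundaries : {pred (cocycles C i)} :=
  fun z => `[< is_coboundary (cocycle_val z) >].

Lemma coboundaries_submod_closed : submod_closed coboundaries.
Proof.
split=> [|a [x xZ] [y yZ]]; rewrite !unfold_in.
  by apply/asboolP; case: i => //= j; exists 0; rewrite linear0.
move=> /asboolP /= xB /asboolP /= yB; apply/asboolP => /=.
case: i x y {xZ yZ} xB yB => [|j] x y /=; first by move=> -> ->; rewrite scaler0 addr0.
by move=> [x' ->] [y' ->]; exists (a *: x' + y'); rewrite linearP.
Qed.
HB.instance Definition _ :=
  GRing.isSubmodClosed.Build K (cocycles C i) coboundaries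
    coboundaries_submod_closed.

Definition cohomology : Type := lmod_quot coboundaries.
HB.instance Definition _ := GRing.Lmodule.on cohomology.
End CohomologyQuotient.

Record gmodule (gT : finGroupType) (K : fieldType) := GModule {
  gcarrier :> lmodType K;
  gact : gT -> {linear gcarrier -> gcarrier};
  gact1 : forall m, gact 1%g m = m;
  gactM : forall g h m, gact (g * h)%g m = gact g (gact h m)
}.

Definition trivial_gmodule (gT : finGroupType) (K : fieldType) : gmodule gT K :=
  @GModule gT K K^o (fun _ => idfun) (fun _ => erefl) (fun _ _ _ => erefl).

Section GroupCohomology.
Variables (gT : finGroupType) (K : fieldType) (M : gmodule gT K).

Definition group_cochain (i : nat) : lmodType K := {ffun {ffun 'I_i -> gT} -> M}.

(* For g = (g_0, ..., g_i): face 0 g = (g_1, ..., g_i),                       *)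
(* face j g = (g_0, ..., g_(j-1) g_j, ..., g_i) for 0 < j < i.+1 and          *)
(* face i.+1 g = (g_0, ..., g_(i-1)).                                         *)
Definition face (i : nat) (j : nat) (g : {ffun 'I_i.+1 -> gT}) : {ffun 'I_i -> gT} :=
  [ffun l : 'I_i => if (l.+1 < j)%N then g (inord l)
                    else if l.+1 == j then (g (inord l) * g (inord l.+1))%g
                    else g (inord l.+1)].

Definition coface (i : nat) (j : nat) (f : group_cochain i) (g : {ffun 'I_i.+1 -> gT}) : M :=
  if j == 0%N then gact M (g ord0) (f (face j g)) else f (face j g).

Definition group_codiff_fun (i : nat) (f : group_cochain i) : group_cochain i.+1 :=
  [ffun g => \sum_(j < i.+2) (-1) ^+ j *: coface j f g].

Lemma group_codiff_linear i : linear (@group_codiff_fun i).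
Proof.
move=> a f1 f2; apply/ffunP => g; rewrite !ffunE scaler_sumr -big_split /=.
apply: eq_bigr => j _; rewrite scalerA mulrC -scalerA -scalerDr /coface.
by case: eqP => _; rewrite !ffunE ?linearP.
Qed.
HB.instance Definition _ i := GRing.isLinear.Build K (group_cochain i)
  (group_cochain i.+1) _ (@group_codiff_fun i) (@group_codiff_linear i).

Lemma face_face i j l (g : {ffun 'I_i.+2 -> gT}) :
  (j <= l)%N -> face l (face j g) = face j (face l.+1 g).
Proof.
move=> lejl; apply/ffunP => x; rewrite !ffunE.
have lx : (x < i.+1)%N by rewrite (leq_trans (ltn_ord x)).
have lx1 : (x.+1 < i.+1)%N by rewrite ltnS.
rewrite !inordK // !ltnS !eqSS.
case: (ltngtP x.+1 l) => h1; case: (ltngtP x.+1 j) => h2;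
  case: (ltngtP x l) => h3; case: (ltngtP x.+2 j) => h4 //;
  rewrite ?mulgA //; try lia.
all: try (by rewrite !(ltn_eqF, gtn_eqF); lia).
Qed.

Lemma coface_coface i j l (f : group_cochain i) (g : {ffun 'I_i.+2 -> gT}) :
  (j <= l)%N ->
  coface j [ffun h => coface l f h] g = coface l.+1 [ffun h => coface j f h] g.
Proof.
move=> lejl; rewrite /coface /= !ffunE face_face //.
case: j lejl => [|j] lejl; case: l lejl => [|l] lejl //=.
  by rewrite -gactM -(inord_val (ord0 : 'I_i.+2)).
by rewrite -(inord_val (ord0 : 'I_i.+2)).
Qed.

Lemma group_codiffK i (f : group_cochain i) :
  group_codiff_fun (group_codiff_fun f) = 0.
Proof.
apply/ffunP => g; rewrite !ffunE.
pose a j l := coface j [ffun h => coface l f h] g.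
have -> : \sum_(j < i.+3) (-1) ^+ j *: coface j (group_codiff_fun f) g =
          \sum_(j < i.+3) \sum_(l < i.+2) (-1) ^+ (j + l) *: a j l.
  apply: eq_bigr => j _; rewrite /a /coface ffunE; case: eqP => _.
    rewrite linear_sum scaler_sumr; apply: eq_bigr => l _.
    by rewrite linearZ /= scalerA -exprD ffunE.
  by rewrite scaler_sumr; apply: eq_bigr => l _; rewrite scalerA -exprD ffunE.
rewrite pair_bigA /= (bigID (fun p : 'I_i.+3 * 'I_i.+2 => (p.1 <= p.2)%N)) /=.
pose h (p : 'I_i.+3 * 'I_i.+2) : 'I_i.+3 * 'I_i.+2 := (lift ord0 p.2, inord p.1).
pose h' (p : 'I_i.+3 * 'I_i.+2) : 'I_i.+3 * 'I_i.+2 := (inord p.2, inord p.1.-1).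
rewrite [X in _ + X](reindex_onto h h') /=; last first.
  move=> [p q] /=; rewrite -ltnNge => lt_qp; congr pair; apply: val_inj => /=.
    rewrite /bump inordK /=; have := ltn_ord p; lia.
  by rewrite !inordK //; have := ltn_ord q; lia.
rewrite [X in _ + X](eq_bigl (fun p : 'I_i.+3 * 'I_i.+2 => (p.1 <= p.2)%N)); last first.
  move=> [p q] /=; rewrite /bump /=; have := ltn_ord q; have := ltn_ord p => hp hq.
  case: (leqP p q) => lpq.
    rewrite inordK; last by lia.
    rewrite -ltnNge add1n ltnS lpq /= xpair_eqE; apply/andP; split; apply/eqP/val_inj.
      by rewrite /= !inordK //; lia.
    by rewrite /h /= inordK.
  apply/negP => /andP[] h1 /eqP [] h2 h3.
  have := congr1 val h2; rewrite /= inordK; last first.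
    by have := ltn_ord (inord p : 'I_i.+2); lia.
  move=> h4; move: h1; rewrite h4; lia.
rewrite -big_split big1 //= => -[p q] /= lpq.
have hq := ltn_ord q; rewrite /bump /= inordK; last by lia.
rewrite add1n /a coface_coface // addSn exprS mulN1r scaleNr addnC.
by rewrite subrr.
Qed.

Definition group_complex : cochain_complex K :=
  @CochainComplex K group_cochain (fun i => @group_codiff_fun i : {linear _ -> _})
    group_codiffK.

Definition group_cohomology (i : nat) : lmodType K := cohomology group_complex i.

End GroupCohomology.

Record vect_le (k : fieldType) (n : nat) := VectLe {
  vect_le_space :> vectType k;
  vect_le_dim : (\dim {:vect_le_space} <= n)%N
}.

Record vfunctor (k : fieldType) (n : nat) := VFunctor {
  fobj :> vect_le k n -> vectType k;
  fmap : forall V W : vect_le k n, 'Hom(V, W) -> 'Hom(fobj V, fobj W);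
  fmap1 : forall V : vect_le k n, fmap (\1%VF : 'Hom(V, V)) = \1%VF;
  fmap_comp : forall (U V W : vect_le k n) (g : 'Hom(V, W)) (f : 'Hom(U, V)),
    fmap (g \o f)%VF = (fmap g \o fmap f)%VF
}.

Record nattrans (k : fieldType) (n : nat) (F G : vfunctor k n) := NatTrans {
  nt_app :> forall V : vect_le k n, 'Hom(F V, G V);
  nt_natural : forall (V W : vect_le k n) (f : 'Hom(V, W)),
    (nt_app W \o fmap F f)%VF = (fmap G f \o nt_app V)%VF
}.

Section NatTrans.
Variables (k : fieldType) (n : nat).
Implicit Types F G H : vfunctor k n.

Lemma nattransP F G (a b : nattrans F G) : (forall V x, a V x = b V x) -> a = b.
Proof.
case: a b => [a aN] [b bN] /= eq_ab.
have e : a = b by apply: functional_extensionality_dep => V; apply/lfunP/eq_ab.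
by subst b; congr NatTrans; apply: Prop_irrelevance.
Qed.

Lemma nt_naturalE F G (a : nattrans F G) (V W : vect_le k n) (f : 'Hom(V, W)) x :
  a W (fmap F f x) = fmap G f (a V x).
Proof. by have /lfunP/(_ x) := nt_natural a f; rewrite !comp_lfunE. Qed.

Lemma fmap1E F (V : vect_le k n) x : fmap F (\1%VF : 'Hom(V, V)) x = x.
Proof. by rewrite fmap1 id_lfunE. Qed.

Lemma fmap_compE F (U V W : vect_le k n) (g : 'Hom(V, W)) (f : 'Hom(U, V)) x :
  fmap F (g \o f)%VF x = fmap F g (fmap F f x).
Proof. by rewrite fmap_comp comp_lfunE. Qed.

Lemma nt_id_natural F (V W : vect_le k n) (f : 'Hom(V, W)) :
  (\1 \o fmap F f)%VF = (fmap F f \o \1)%VF.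
Proof. by rewrite comp_lfun1l comp_lfun1r. Qed.
Definition nt_id F : nattrans F F := NatTrans (@nt_id_natural F).

Lemma nt_comp_natural F G H (b : nattrans G H) (a : nattrans F G)
    (V W : vect_le k n) (f : 'Hom(V, W)) :
  (b W \o a W \o fmap F f)%VF = (fmap H f \o (b V \o a V))%VF.
Proof. by apply/lfunP => x; rewrite !comp_lfunE !nt_naturalE. Qed.
Definition nt_comp F G H (b : nattrans G H) (a : nattrans F G) : nattrans F H :=
  NatTrans (nt_comp_natural b a).

Section Operations.
Variables F G : vfunctor k n.
Implicit Types a b : nattrans F G.

Lemma nt_zero_natural (V W : vect_le k n) (f : 'Hom(V, W)) :
  ((0 : 'Hom(F W, G W)) \o fmap F f)%VF = (fmap G f \o 0)%VF.
Proof. by rewrite comp_lfun0l comp_lfun0r. Qed.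
Definition nt_zero : nattrans F G := NatTrans nt_zero_natural.

Lemma nt_add_natural a b (V W : vect_le k n) (f : 'Hom(V, W)) :
  ((a W + b W) \o fmap F f)%VF = (fmap G f \o (a V + b V))%VF.
Proof. by rewrite comp_lfunDl comp_lfunDr !nt_natural. Qed.
Definition nt_add a b : nattrans F G := NatTrans (nt_add_natural a b).

Lemma nt_scale_natural (c : k) a (V W : vect_le k n) (f : 'Hom(V, W)) :
  ((c *: a W) \o fmap F f)%VF = (fmap G f \o (c *: a V))%VF.
Proof. by rewrite -comp_lfunZl -comp_lfunZr nt_natural. Qed.
Definition nt_scale (c : k) a : nattrans F G := NatTrans (nt_scale_natural c a).

End Operations.

Lemma vect_std_dim : (\dim {:'rV[k]_n} <= n)%N.
Proof. by rewrite dimvf /dim /= mul1n. Qed.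
Definition vect_std : vect_le k n := VectLe vect_std_dim.

Lemma vect_le_retract (V : vect_le k n) :
  exists (s : 'Hom(V, vect_std)) (r : 'Hom(vect_std, V)), (r \o s)%VF = \1%VF.
Proof.
pose d := \dim {:V}; pose e : d.-tuple V := vbasis {:V}.
pose w (i : 'I_d) : 'I_n := widen_ord (vect_le_dim V) i.
pose s (v : V) : 'rV[k]_n := \sum_(i < d) coord e i v *: delta_mx 0 (w i).
pose r (u : 'rV[k]_n) : V := \sum_(i < d) u 0 (w i) *: e`_i.
have slin : linear s.
  move=> a x y; rewrite /s scaler_sumr -big_split /=; apply: eq_bigr => i _.
  by rewrite linearP /= scalerDl scalerA.
have rlin : linear r.
  move=> a x y; rewrite /r scaler_sumr -big_split /=; apply: eq_bigr => i _.
  by rewrite !mxE scalerDl scalerA.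
pose sL : {linear V -> 'rV[k]_n} := HB.pack s (GRing.isLinear.Build _ _ _ _ s slin).
pose rL : {linear 'rV[k]_n -> V} := HB.pack r (GRing.isLinear.Build _ _ _ _ r rlin).
exists (linfun sL), (linfun rL); apply/lfunP => v.
rewrite id_lfunE comp_lfunE !lfunE /= /r [RHS](coord_vbasis (memvf v)).
apply: eq_bigr => i _; congr (_ *: _); rewrite /s summxE (bigD1 i) //=.
rewrite big1 ?addr0 => [|j /negPf ne_ji]; first by rewrite !mxE !eqxx mulr1.
by rewrite !mxE eqxx /= -(inj_eq val_inj) /= eq_sym (inj_eq val_inj) ne_ji mulr0.
Qed.

Lemma nattrans_std_inj F G (a b : nattrans F G) : a vect_std = b vect_std -> a = b.
Proof.
move=> eq_ab; apply: nattransP => V x.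
have [s [r rs]] := vect_le_retract V.
by rewrite -[x]fmap1E -rs fmap_compE (nt_naturalE a r) (nt_naturalE b r) eq_ab.
Qed.

Section NatHom.
Variables F G : vfunctor k n.

(* [nattrans F G] quantifies over all vector spaces, and hence lives in too   *)
(* large a universe to carry an [lmodType] structure. By [nattrans_std_inj] a *)
(* natural transformation is determined by its component at k^n: [nat_hom F G]*)
(* is the set of these components, in bijection with [nattrans F G] through   *)
(* [nat_hom_of] and [nattrans_of].                                            *)
Definition is_nat_hom : {pred 'Hom(F vect_std, G vect_std)} :=
  fun f => `[< exists a : nattrans F G, a vect_std = f >].

Lemma is_nat_hom_submod_closed : submod_closed is_nat_hom.
Proof.
split=> [|c f g /asboolP [a <-] /asboolP [b <-]]; apply/asboolP.
  by exists (nt_zero F G).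
by exists (nt_add (nt_scale c a) b).
Qed.
HB.instance Definition _ :=
  GRing.isSubmodClosed.Build k 'Hom(F vect_std, G vect_std) is_nat_hom
    is_nat_hom_submod_closed.

Record nat_hom : Type := NatHom {
  nat_hom_val : 'Hom(F vect_std, G vect_std);
  _ : is_nat_hom nat_hom_val
}.
HB.instance Definition _ := [isSub for nat_hom_val].
HB.instance Definition _ := [Choice of nat_hom by <:].
HB.instance Definition _ := [SubChoice_isSubLmodule of nat_hom by <:].

Definition nat_hom_of (a : nattrans F G) : nat_hom :=
  @NatHom (a vect_std) (introT (asboolP _) (ex_intro _ a erefl)).

Definition nattrans_of (f : nat_hom) : nattrans F G :=
  projT1 (cid (elimT (asboolP _) (valP f))).

Lemma nattrans_of_std f : nattrans_of f vect_std = nat_hom_val f.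
Proof. by rewrite /nattrans_of; case: cid. Qed.

Lemma nattrans_ofK : cancel nattrans_of nat_hom_of.
Proof. by move=> f; apply: val_inj; rewrite /= nattrans_of_std. Qed.

Lemma nat_hom_ofK : cancel nat_hom_of nattrans_of.
Proof. by move=> a; apply: nattrans_std_inj; rewrite nattrans_of_std. Qed.

Lemma nattrans_of_linear (c : k) (f g : nat_hom) (V : vect_le k n) :
  nattrans_of (c *: f + g) V = c *: nattrans_of f V + nattrans_of g V.
Proof.
have -> : nattrans_of (c *: f + g) =
          nt_add (nt_scale c (nattrans_of f)) (nattrans_of g).
  by apply: nattrans_std_inj; rewrite /= !nattrans_of_std.
by [].
Qed.
End NatHom.

Definition nat_hom_precomp F G H (a : nattrans F G) (b : nat_hom G H) : nat_hom F H :=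
  nat_hom_of (nt_comp (nattrans_of b) a).

Lemma nat_hom_precomp_linear F G H (a : nattrans F G) :
  linear (@nat_hom_precomp F G H a).
Proof.
move=> c f g; apply: val_inj => /=.
by rewrite nattrans_of_linear comp_lfunDl -comp_lfunZl.
Qed.
HB.instance Definition _ F G H (a : nattrans F G) :=
  GRing.isLinear.Build k (nat_hom G H) (nat_hom F H) _ (@nat_hom_precomp F G H a)
    (@nat_hom_precomp_linear F G H a).

End NatTrans.

(* Epimorphisms, kernels and images of natural transformations are computed   *)
(* objectwise.                                                                *)
Definition nt_epi (k : fieldType) (n : nat) (F G : vfunctor k n) (a : nattrans F G) :=
  forall V : vect_le k n, limg (a V) = fullv.

Definition nt_exact (k : fieldType) (n : nat) (F G H : vfunctor k n)
    (a : nattrans F G) (b : nattrans G H) :=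
  forall V : vect_le k n, limg (a V) = lker (b V).

Definition projective (k : fieldType) (n : nat) (P : vfunctor k n) :=
  forall (F G : vfunctor k n) (p : nattrans F G) (f : nattrans P G), nt_epi p ->
  exists g : nattrans P F, nt_comp p g = f.

Record proj_resolution (k : fieldType) (n : nat) (F : vfunctor k n) :=
  ProjResolution {
    res_obj :> nat -> vfunctor k n;
    res_diff : forall i, nattrans (res_obj i.+1) (res_obj i);
    res_aug : nattrans (res_obj 0) F;
    res_projective : forall i, projective (res_obj i);
    res_epi : nt_epi res_aug;
    res_exact0 : nt_exact (res_diff 0) res_aug;
    res_exact : forall i, nt_exact (res_diff i.+1) (res_diff i)
  }.

Section HomComplex.
Variables (k : fieldType) (n : nat) (F : vfunctor k n) (P : proj_resolution F).
Variable G : vfunctor k n.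

Definition hom_cochain (i : nat) : lmodType k := nat_hom (P i) G.

Lemma hom_codiffK i (a : hom_cochain i) :
  nat_hom_precomp (res_diff P i.+1) (nat_hom_precomp (res_diff P i) a) = 0.
Proof.
apply: val_inj => /=; rewrite nat_hom_ofK; apply/lfunP => x.
rewrite /= !comp_lfunE /= zero_lfunE.
have : res_diff P i.+1 _ x \in lker (res_diff P i _).
  by rewrite -(res_exact P) memv_img ?memvf.
by rewrite memv_ker => /eqP ->; rewrite linear0.
Qed.

Definition hom_complex : cochain_complex k :=
  @CochainComplex k hom_cochain
    (fun i => nat_hom_precomp (res_diff P i) : {linear _ -> _}) hom_codiffK.
End HomComplex.

Section StandardResolution.
Variables (k : finFieldType) (n : nat).
Local Notation std := (vect_std k n).

(* [free_functor F] is V |-> k[Hom(k^n, V)] (x) F(k^n), which is finite       *)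
(* dimensional as k is finite: phi stands for the sum of the [f] (x) phi f.   *)
Section FreeFunctor.
Variable F : vfunctor k n.

Definition free_hom (V : vect_le k n) : finType := finvect_type 'Hom(std, V).

Definition free_obj (V : vect_le k n) : vectType k := {ffun free_hom V -> F std}.

Definition free_map_fun (V W : vect_le k n) (g : 'Hom(V, W))
    (phi : free_obj V) : free_obj W :=
  [ffun h : free_hom W => \sum_(f : free_hom V | (g \o f)%VF == h :> free_hom W) phi f].

Lemma free_map_linear V W g : linear (@free_map_fun V W g).
Proof.
move=> a x y; apply/ffunP => h; rewrite !ffunE scaler_sumr -big_split /=.
by apply: eq_bigr => f _; rewrite !ffunE.
Qed.
HB.instance Definition _ V W g :=
  GRing.isLinear.Build k (free_obj V) (free_obj W) _ (@free_map_fun V W g)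
    (@free_map_linear V W g).

Definition free_map (V W : vect_le k n) (g : 'Hom(V, W)) : 'Hom(free_obj V, free_obj W) :=
  linfun (free_map_fun g).

Lemma free_mapE (V W : vect_le k n) (g : 'Hom(V, W)) phi (h : free_hom W) :
  free_map g phi h = \sum_(f : free_hom V | (g \o f)%VF == h :> free_hom W) phi f.
Proof. by rewrite lfunE ffunE. Qed.

Lemma free_map1 (V : vect_le k n) : free_map (\1%VF : 'Hom(V, V)) = \1%VF.
Proof.
apply/lfunP => phi; apply/ffunP => h; rewrite free_mapE id_lfunE.
by rewrite (big_pred1 h) // => f; rewrite comp_lfun1l.
Qed.

Lemma free_map_comp (U V W : vect_le k n) (g : 'Hom(V, W)) (f : 'Hom(U, V)) :
  free_map (g \o f)%VF = (free_map g \o free_map f)%VF.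
Proof.
apply/lfunP => phi; apply/ffunP => h; rewrite comp_lfunE !free_mapE.
rewrite (partition_big (fun u : free_hom U => (f \o u)%VF : free_hom V)
  (fun v : free_hom V => (g \o v)%VF == h :> free_hom W)) /=; last first.
  by move=> u; rewrite comp_lfunA.
apply: eq_bigr => v /eqP <-; rewrite free_mapE; apply: eq_bigl => u.
apply: andb_idl => /eqP <-; exact/eqP/esym/comp_lfunA.
Qed.

Definition free_functor : vfunctor k n := VFunctor free_map1 free_map_comp.

(* [f] (x) x |-> F(f)(x) *)
Definition free_aug_fun (V : vect_le k n) (phi : free_obj V) : F V :=
  \sum_(f : free_hom V) fmap F f (phi f).

Lemma free_aug_linear V : linear (@free_aug_fun V).
Proof.
move=> a x y; rewrite /free_aug_fun scaler_sumr -big_split /=.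
by apply: eq_bigr => f _; rewrite !ffunE linearP.
Qed.
HB.instance Definition _ V :=
  GRing.isLinear.Build k (free_obj V) (F V) _ (@free_aug_fun V)
    (@free_aug_linear V).

Definition free_aug_app (V : vect_le k n) : 'Hom(free_functor V, F V) :=
  linfun (@free_aug_fun V).

Lemma free_aug_natural (V W : vect_le k n) (f : 'Hom(V, W)) :
  (free_aug_app W \o fmap free_functor f)%VF = (fmap F f \o free_aug_app V)%VF.
Proof.
apply/lfunP => phi; rewrite !comp_lfunE [LHS]lfunE [free_aug_app V phi]lfunE /=.
rewrite /free_aug_fun linear_sum /=.
under eq_bigr do rewrite free_mapE linear_sum.
rewrite (exchange_big_dep xpredT) //=; apply: eq_bigr => u _.
by rewrite (big_pred1 ((f \o u)%VF : free_hom W)) => [|w]; rewrite ?fmap_compE // eq_sym.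
Qed.
Definition free_aug : nattrans free_functor F := NatTrans free_aug_natural.

Definition free_single (V : vect_le k n) (f : 'Hom(std, V)) (x : F std) :
    free_functor V :=
  [ffun h : free_hom V => if h == f :> free_hom V then x else 0].

Lemma free_aug_single V f x : free_aug V (free_single f x) = fmap F f x.
Proof.
rewrite lfunE /= /free_aug_fun (bigD1 (f : free_hom V)) //= ffunE eqxx.
by rewrite big1 ?addr0 // => h /negPf ne; rewrite ffunE ne linear0.
Qed.

Lemma free_single_linear V f : linear (@free_single V f).
Proof.
by move=> a x y; apply/ffunP => h; rewrite !ffunE; case: eqP; rewrite ?scaler0 ?addr0.
Qed.

Lemma fmap_free_single (V W : vect_le k n) (g : 'Hom(V, W)) f x :
  fmap free_functor g (free_single f x) = free_single (g \o f)%VF x.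
Proof.
apply/ffunP => h; rewrite free_mapE ffunE.
rewrite (eq_bigr (fun u : free_hom V => if u == f then x else 0)); last first.
  by move=> u _; rewrite ffunE.
rewrite -big_mkcondr /=; case: eqP => [->|ne].
  by rewrite (big_pred1 (f : free_hom V)) // => u /=; rewrite andb_idl // => /eqP ->.
by rewrite big_pred0 // => u; apply/negP => /andP[/eqP guh /eqP uf]; case: ne; rewrite -guh uf.
Qed.

Lemma free_single_sum (V : vect_le k n) (phi : free_functor V) :
  phi = \sum_(f : free_hom V) free_single f (phi f).
Proof.
apply/ffunP => h; rewrite sum_ffunE (bigD1 h) //= ffunE eqxx.
by rewrite big1 ?addr0 // => f /negPf ne; rewrite ffunE eq_sym ne.
Qed.

Lemma free_aug_epi : nt_epi free_aug.
Proof.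
move=> V; apply/eqP; rewrite eqEsubv subvf; apply/subvP => x _.
have [s [r rs]] := vect_le_retract V.
apply/memv_imgP; exists (free_single r (fmap F s x)); first exact: memvf.
by rewrite free_aug_single -fmap_compE rs fmap1E.
Qed.

Lemma free_projective : projective free_functor.
Proof.
move=> G H p f p_epi.
pose sec := (p std)^-1%VF; have secK x : p std (sec x) = x.
  by apply: limg_lfunVK; rewrite p_epi memvf.
pose g0 V (phi : free_functor V) : G V := \sum_(u : free_hom V)
  fmap G u (sec (f std (free_single \1%VF (phi u)))).
have g0lin V : linear (g0 V).
  move=> a x y; rewrite /g0 scaler_sumr -big_split /=; apply: eq_bigr => u _.
  by rewrite !ffunE free_single_linear !linearP.
pose gL V : {linear free_functor V -> G V} :=
  HB.pack (g0 V) (GRing.isLinear.Build _ _ _ _ _ (g0lin V)).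
pose g V : 'Hom(free_functor V, G V) := linfun (gL V).
have g_single V u x :
    g V (free_single u x) = fmap G u (sec (f std (free_single \1%VF x))).
  rewrite lfunE /= /g0 (bigD1 (u : free_hom V)) //= ffunE eqxx.
  rewrite big1 ?addr0 // => h /negPf ne; rewrite ffunE ne.
  have -> : free_single (\1%VF : 'Hom(std, std)) (0 : F std) = 0.
    by apply/ffunP => v; rewrite !ffunE; case: eqP.
  by rewrite !linear0.
have gN (V W : vect_le k n) (h : 'Hom(V, W)) :
    (g W \o fmap free_functor h)%VF = (fmap G h \o g V)%VF.
  apply/lfunP => phi; rewrite !comp_lfunE (free_single_sum phi) !linear_sum /=.
  by apply: eq_bigr => u _; rewrite fmap_free_single !g_single fmap_compE.
exists (NatTrans gN); apply: nattransP => V phi; rewrite /= comp_lfunE.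
rewrite (free_single_sum phi) !linear_sum /=; apply: eq_bigr => u _.
by rewrite g_single nt_naturalE secK -nt_naturalE fmap_free_single comp_lfun1r.
Qed.

End FreeFunctor.

Section KernelFunctor.
Variables (F G : vfunctor k n) (a : nattrans F G).

Definition ker_obj (V : vect_le k n) : vectType k := subvs_of (lker (a V)).

Definition ker_map (V W : vect_le k n) (f : 'Hom(V, W)) : 'Hom(ker_obj V, ker_obj W) :=
  linfun (@vsproj k (F W) (lker (a W)) \o fmap F f \o @vsval k (F V) (lker (a V))).

Lemma ker_mapE (V W : vect_le k n) (f : 'Hom(V, W)) x : vsval (ker_map f x) = fmap F f (vsval x).
Proof.
rewrite lfunE /= vsprojK // memv_ker nt_naturalE.
by have := subvsP x; rewrite memv_ker => /eqP ->; rewrite linear0.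
Qed.

Lemma ker_map1 (V : vect_le k n) : ker_map (\1%VF : 'Hom(V, V)) = \1%VF.
Proof. by apply/lfunP => x; apply: subvs_inj; rewrite ker_mapE fmap1E id_lfunE. Qed.

Lemma ker_map_comp (U V W : vect_le k n) (g : 'Hom(V, W)) (f : 'Hom(U, V)) :
  ker_map (g \o f)%VF = (ker_map g \o ker_map f)%VF.
Proof.
by apply/lfunP => x; apply: subvs_inj; rewrite comp_lfunE !ker_mapE fmap_compE.
Qed.

Definition ker_functor : vfunctor k n := VFunctor ker_map1 ker_map_comp.

Definition ker_incl_app (V : vect_le k n) : 'Hom(ker_functor V, F V) :=
  linfun (@vsval k (F V) (lker (a V))).

Lemma ker_incl_natural (V W : vect_le k n) (f : 'Hom(V, W)) :
  (ker_incl_app W \o fmap ker_functor f)%VF = (fmap F f \o ker_incl_app V)%VF.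
Proof. by apply/lfunP => x; rewrite !comp_lfunE [LHS]lfunE [ker_incl_app V x]lfunE /= ker_mapE. Qed.
Definition ker_incl : nattrans ker_functor F := NatTrans ker_incl_natural.

Lemma limg_ker_incl V : limg (ker_incl V) = lker (a V).
Proof.
apply/vspaceP => x; apply/memv_imgP/idP => [[y _ ->]|xK].
  by rewrite lfunE /= subvsP.
by exists (Subvs xK); rewrite ?memvf // lfunE.
Qed.

Lemma lker_ker_incl V : lker (ker_incl V) = 0%VS.
Proof.
apply/eqP/lker0P => x y; rewrite !lfunE /= => eq_xy; exact: val_inj.
Qed.
End KernelFunctor.

Fixpoint syzygy (F : vfunctor k n) (i : nat) : vfunctor k n :=
  match i with
  | 0 => F
  | j.+1 => ker_functor (free_aug (syzygy F j))
  end.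

Variable F : vfunctor k n.

Definition std_res_obj (i : nat) : vfunctor k n := free_functor (syzygy F i).

Definition std_res_diff (i : nat) : nattrans (std_res_obj i.+1) (std_res_obj i) :=
  nt_comp (ker_incl (free_aug (syzygy F i))) (free_aug (syzygy F i.+1)).

Lemma limg_std_res_diff i V : limg (std_res_diff i V) = lker (free_aug (syzygy F i) V).
Proof. by rewrite limg_comp free_aug_epi limg_ker_incl. Qed.

Lemma std_res_exact i : nt_exact (std_res_diff i.+1) (std_res_diff i).
Proof.
move=> V; rewrite limg_std_res_diff; apply/vspaceP => x.
rewrite !memv_ker /= comp_lfunE -[RHS]memv_ker lker_ker_incl memv0.
by [].
Qed.

Definition std_resolution : proj_resolution F :=
  ProjResolution (res_obj := std_res_obj) (res_diff := std_res_diff)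
    (res_aug := free_aug F) (fun i => @free_projective (syzygy F i))
    (@free_aug_epi F) (limg_std_res_diff 0) std_res_exact.

End StandardResolution.

(* Computed from the functorial resolution iterating [free_functor]; it is a  *)
(* projective resolution by the type of [std_resolution].                     *)
Definition Ext (k : finFieldType) (n : nat) (i : nat) (F G : vfunctor k n) : lmodType k :=
  cohomology (hom_complex (std_resolution F) G) i.

Section ExteriorPower.
Variables (k : finFieldType) (m : nat).

Section Object.
Variable V : vectType k.

Definition vtuple : finType := {ffun 'I_m -> finvect_type V}.

(* The m-th exterior power of V is presented as k[V^m] modulo the relations   *)
(* of alternating multilinear maps; V^m is finite as k is.                    *)
Definition formal_tensor : vectType k := {ffun vtuple -> k^o}.

Definition ftensor (v : vtuple) : formal_tensor := [ffun u => (u == v)%:R].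

Definition vupdate (v : vtuple) (i : 'I_m) (x : V) : vtuple :=
  [ffun j => if j == i then x else v j].

Definition multilinear_rel : {vspace formal_tensor} :=
  (\sum_(v : vtuple) \sum_(i < m) \sum_(a : k)
    \sum_(x : finvect_type V) \sum_(y : finvect_type V)
      <[ftensor (vupdate v i (a *: x + y))
        - a *: ftensor (vupdate v i x) - ftensor (vupdate v i y)]>)%VS.

Definition alternating_rel : {vspace formal_tensor} :=
  (\sum_(v : vtuple | ~~ injectiveb v) <[ftensor v]>)%VS.

Definition ext_rel : {vspace formal_tensor} := (multilinear_rel + alternating_rel)%VS.

Definition ext_power : vectType k := vect_quot ext_rel.

Definition wedge (v : vtuple) : ext_power := vect_quot_pi ext_rel (ftensor v).
End Object.

Section Functoriality.
Variables (V W : vectType k) (f : 'Hom(V, W)).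

Definition vtuple_map (v : vtuple V) : vtuple W := [ffun i => f (v i)].

Definition ftensor_map_fun (phi : formal_tensor V) : formal_tensor W :=
  \sum_(v : vtuple V) phi v *: ftensor (vtuple_map v).

Lemma ftensor_map_linear : linear ftensor_map_fun.
Proof.
move=> a x y; rewrite /ftensor_map_fun scaler_sumr -big_split /=.
by apply: eq_bigr => v _; rewrite !ffunE scalerDl scalerA.
Qed.
HB.instance Definition _ :=
  GRing.isLinear.Build k (formal_tensor V) (formal_tensor W) _ ftensor_map_fun
    ftensor_map_linear.

Definition ftensor_map : 'Hom(formal_tensor V, formal_tensor W) := linfun ftensor_map_fun.

Lemma ftensor_mapE v : ftensor_map (ftensor v) = ftensor (vtuple_map v).
Proof.
rewrite lfunE /= /ftensor_map_fun (bigD1 v) //= ffunE eqxx scale1r.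
by rewrite big1 ?addr0 // => u /negPf ne; rewrite ffunE ne scale0r.
Qed.

Lemma vtuple_map_update v i x :
  vtuple_map (vupdate v i x) = vupdate (vtuple_map v) i (f x).
Proof. by apply/ffunP => j; rewrite !ffunE; case: eqP. Qed.

Lemma mem_multilinear_rel (v : vtuple W) i a x y :
  ftensor (vupdate v i (a *: x + y)) - a *: ftensor (vupdate v i x)
    - ftensor (vupdate v i y) \in multilinear_rel W.
Proof.
rewrite memvE.
apply: (sumv_sup v) => //; apply: (sumv_sup i) => //; apply: (sumv_sup a) => //.
by apply: (sumv_sup (x : finvect_type W)) => //; apply: (sumv_sup (y : finvect_type W)).
Qed.

Lemma mem_alternating_rel (v : vtuple W) :
  ~~ injectiveb v -> ftensor v \in alternating_rel W.
Proof. by move=> vN; rewrite memvE; apply: (sumv_sup v). Qed.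

Lemma ftensor_map_rel : (ftensor_map @: ext_rel V <= ext_rel W)%VS.
Proof.
rewrite /ext_rel limgD subv_add; apply/andP; split.
  rewrite limg_sum; apply/subv_sumP => v _; rewrite limg_sum; apply/subv_sumP => i _.
  rewrite limg_sum; apply/subv_sumP => a _; rewrite limg_sum; apply/subv_sumP => x _.
  rewrite limg_sum; apply/subv_sumP => y _; rewrite limg_line -memvE.
  rewrite !linearB linearZ /= !ftensor_mapE !vtuple_map_update linearP.
  by apply: (subvP (addvSl _ _)); apply: mem_multilinear_rel.
rewrite limg_sum; apply/subv_sumP => v vN; rewrite limg_line -memvE ftensor_mapE.
apply: (subvP (addvSr _ _)); apply: mem_alternating_rel.
apply: contra vN => /injectiveP inj; apply/injectiveP => i j eq_v; apply: inj.
by rewrite !ffunE eq_v.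
Qed.

Definition ext_power_map : 'Hom(ext_power V, ext_power W) :=
  vect_quot_map (ext_rel V) (ext_rel W) ftensor_map.

Lemma ext_power_mapE v : ext_power_map (wedge v) = wedge (vtuple_map v).
Proof. by rewrite (vect_quot_mapE ftensor_map_rel) ftensor_mapE. Qed.
End Functoriality.

Lemma wedge_spanP (V : vectType k) (W : vectType k) (f g : 'Hom(ext_power V, W)) :
  (forall v, f (wedge v) = g (wedge v)) -> f = g.
Proof.
move=> eq_fg; apply/lfunP => q; have [phi <-] := vect_quot_pi_surj q.
have -> : phi = \sum_(v : vtuple V) phi v *: ftensor v.
  apply/ffunP => u; rewrite sum_ffunE (bigD1 u) //= big1 ?addr0.
    by rewrite !ffunE eqxx; apply/esym/mulr1.
  by move=> v /negPf ne; rewrite !ffunE eq_sym ne scaler0.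
by rewrite !linear_sum; apply: eq_bigr => v _; rewrite !linearZ; congr (_ *: _); apply: eq_fg.
Qed.

Lemma ext_power_map1 (n : nat) (V : vect_le k n) :
  ext_power_map (\1%VF : 'Hom(V, V)) = \1%VF.
Proof.
apply: wedge_spanP => v; rewrite ext_power_mapE id_lfunE; congr wedge.
by apply/ffunP => i; rewrite ffunE id_lfunE.
Qed.

Lemma ext_power_map_comp (n : nat) (U V W : vect_le k n)
    (g : 'Hom(V, W)) (f : 'Hom(U, V)) :
  ext_power_map (g \o f)%VF = (ext_power_map g \o ext_power_map f)%VF.
Proof.
apply: wedge_spanP => v; rewrite comp_lfunE !ext_power_mapE; congr wedge.
by apply/ffunP => i; rewrite !ffunE comp_lfunE.
Qed.

Definition exterior_functor (n : nat) : vfunctor k n :=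
  @VFunctor k n (fun V => ext_power V) (fun V W f => ext_power_map f)
    (@ext_power_map1 n) (@ext_power_map_comp n).

End ExteriorPower.

(* Main.v *)
Require Import Defs.
From HB Require Import structures.
From mathcomp Require Import all_boot all_order all_fingroup all_algebra all_field.
From mathcomp Require Import boolp.

(** Let E be the monoid End(k^n). The exterior power Lambda^n(k^n) is a line on
which f in E acts by det f; in particular singular endomorphisms act by zero,
so this line is a representation of GL_n. The group cohomology of GL_n is thus
an Ext of that line with itself over k[GL_n], and the point is that Ext in the
category of functors, that is over k[E], gives the same answer although the
syzygies of Lambda^n are not killed by singular endomorphisms.

Evaluated at k^n, the standard resolution is the exact complex of modules
P_q = k[E] (x) S_q over Lambda^n(k^n), where S_q is the value at k^n of the q-th
syzygy. The heart of the proof is [std_res_acyclic]: the part of this complex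
supported on the singular endomorphisms is itself acyclic. More generally the
part supported on any right ideal X of singular endomorphisms is acyclic. If
X = f E, then X = e E for an idempotent e that kills Lambda^n(k^n), and applying
e to a primitive of a cycle supported on X gives a primitive supported on X. In
general X is a union of two smaller right ideals, one of them principal, and a
Mayer-Vietoris argument concludes by induction on the number of elements of X.

Consequently the quotients Q_q = k[GL_n] (x) S_q form a resolution of
Lambda^n(k^n) by free k[GL_n]-modules, and natural transformations from P_q to
Lambda^n are the GL_n-equivariant maps from Q_q to Lambda^n(k^n). Now consider
the double complex C^p(GL_n, Hom_k(Q_q, Lambda^n(k^n))). It is exact in the
direction p since its coefficients are coinduced ([coind_codiff_exact]), and
the kernel at p = 0 is the complex computing Ext; it is exact in the direction q
since Q is ([res_pull_exact]), and the kernel at q = 0 is the complex of cochains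
of GL_n with values in End(Lambda^n(k^n)) = k ([res_pull0_ker]). The usual
staircase argument ([balancing]) identifies the two cohomologies. *)

Set Implicit Arguments.
Unset Strict Implicit.
Unset Printing Implicit Defensive.

Import GRing.Theory.
Local Open Scope ring_scope.

(** * Subquotients and additive relations *)

Section Subquotients.
Variable K : fieldType.

(** The subquotient num / den of a vector space. Both parts are kept as bare
predicates, so that no quotient has to be formed until the very end. *)
Record subquotient := Subquotient {
  sq_mod : lmodType K;
  sq_num : sq_mod -> Prop;
  sq_den : sq_mod -> Prop
}.

(** An isomorphism of subquotients presented by its graph, an additive relation
in the sense of homological algebra: this composes and inverts at no cost, and
suits zigzags, in which neither direction is given by a function. *)
Definition sq_iso (S T : subquotient) : Prop :=
  exists R : sq_mod S -> sq_mod T -> Prop,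
  [/\ forall a x x' y y', R x y -> R x' y' -> R (a *: x + x') (a *: y + y'),
      forall x y, R x y -> [/\ sq_num x, sq_num y & sq_den x <-> sq_den y],
      forall x, sq_num x -> exists y, R x y
    & forall y, sq_num y -> exists x, R x y].

Lemma sq_iso_sym S T : sq_iso S T -> sq_iso T S.
Proof.
case=> R [Rlin Rnum Rl Rr]; exists (fun y x => R x y); split=> //.
- by move=> a x x' y y'; apply: Rlin.
- by move=> y x /Rnum[? ? [? ?]].
Qed.

Lemma sq_iso_trans S T U : sq_iso S T -> sq_iso T U -> sq_iso S U.
Proof.
case=> R [Rlin Rnum Rl Rr] [Q [Qlin Qnum Ql Qr]].
exists (fun x z => exists2 y, R x y & Q y z); split.
- move=> a x x' z z' [y Rxy Qyz] [y' Rxy' Qyz'].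
  by exists (a *: y + y'); [apply: Rlin | apply: Qlin].
- move=> x z [y /Rnum[xN _ xy] /Qnum[_ zN yz]]; split=> //.
  by split=> [/xy/yz|/yz/xy].
- by move=> x /Rl[y Rxy]; have [_ yN _] := Rnum _ _ Rxy; have [z] := Ql _ yN; exists z, y.
- by move=> z /Qr[y Qyz]; have [yN _ _] := Qnum _ _ Qyz; have [x] := Rr _ yN; exists x, y.
Qed.

Definition cohomology_sq (C : cochain_complex K) i : subquotient :=
  @Subquotient (C i) (fun x => codiff C i x = 0) (@is_coboundary K C i).

Definition cohomology_class (C : cochain_complex K) i (z : cocycles C i) :
  cohomology C i := lmod_quot_pi (@coboundaries K C i) z.

Lemma cohomology_class_surj C i (q : cohomology C i) :
  exists z : cocycles C i, cohomology_class z = q.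
Proof. exact: lmod_quot_pi_surj. Qed.

Lemma cohomology_class_eq C i (z w : cocycles C i) :
  cohomology_class z = cohomology_class w <->
  is_coboundary (cocycle_val z - cocycle_val w).
Proof.
split=> [/eqP|zw].
  by rewrite lmod_quot_pi_eq unfold_in => /asboolP.
by apply/eqP; rewrite lmod_quot_pi_eq unfold_in; apply/asboolP.
Qed.

Lemma cohomology_classP C i a (z w : cocycles C i) :
  cohomology_class (a *: z + w) = a *: cohomology_class z + cohomology_class w.
Proof. exact: lmod_quot_pi_linear. Qed.

Lemma cohomology_sq_iso (C C' : cochain_complex K) i j :
  sq_iso (cohomology_sq C i) (cohomology_sq C' j) ->
  exists f : {linear cohomology C i -> cohomology C' j}, bijective f.
Proof.
case=> R [Rlin Rnum Rl Rr].
(* The relation descends to the graph of a bijection between the quotients. *)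
pose graph (q : cohomology C i) (r : cohomology C' j) :=
  exists z w, [/\ cohomology_class z = q, cohomology_class w = r
                & R (cocycle_val z) (cocycle_val w)].
have Rsub x x' y y' : R x y -> R x' y' -> R (x - x') (y - y').
  by move=> Rxy Rxy'; rewrite -(scaleN1r x') -(scaleN1r y') ![_ + -1 *: _]addrC; apply: Rlin.
have graph_l q : exists r, graph q r.
  have [z <-] := cohomology_class_surj q.
  have [y Ry] := Rl (cocycle_val z) (eqP (valP z)).
  have [_ /eqP yN _] := Rnum _ _ Ry.
  by exists (cohomology_class (Cocycle yN)); exists z, (Cocycle yN).
have graph_r r : exists q, graph q r.
  have [w <-] := cohomology_class_surj r.
  have [x Rx] := Rr (cocycle_val w) (eqP (valP w)).
  have [/eqP xN _ _] := Rnum _ _ Rx.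
  by exists (cohomology_class (Cocycle xN)); exists (Cocycle xN), w.
have graph_eq q q' r r' : graph q r -> graph q' r' -> q = q' <-> r = r'.
  move=> [z [w [<- <- Rzw]]] [z' [w' [<- <- Rzw']]].
  by rewrite !cohomology_class_eq; have [] := Rnum _ _ (Rsub _ _ _ _ Rzw Rzw').
have [f fP] := choice graph_l; have [g gP] := choice graph_r.
have f_lin : linear f.
  move=> a p q; have [z [w [zp wf Rzw]]] := fP p.
  have [z' [w' [zq wf' Rzw']]] := fP q.
  apply/(graph_eq _ (a *: p + q) _ _ (fP _)) => //.
  exists (a *: z + z'), (a *: w + w'); split; last exact: Rlin.
    by rewrite cohomology_classP zp zq.
  by rewrite cohomology_classP wf wf'.
pose fL : {linear cohomology C i -> cohomology C' j} :=
  HB.pack f (GRing.isLinear.Build _ _ _ _ f f_lin).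
exists fL; exists g => [q|r]; first by apply/(graph_eq _ _ _ _ (gP _) (fP q)).
by apply/(graph_eq _ _ _ _ (fP _) (gP r)).
Qed.

End Subquotients.

(** * Balancing a double complex *)

Section Balancing.
Variable K : fieldType.
Variable D : nat -> nat -> lmodType K.
Variable dv : forall p q, {linear D p q -> D p.+1 q}.
Variable dh : forall p q, {linear D p q -> D p q.+1}.
Hypothesis dvK : forall p q x, dv p.+1 q (dv p q x) = 0.
Hypothesis dhK : forall p q x, dh p q.+1 (dh p q x) = 0.
Hypothesis dvh : forall p q x, dv p q.+1 (dh p q x) = dh p.+1 q (dv p q x).
Hypothesis dv_exact : forall p q x, dv p.+1 q x = 0 -> exists y, x = dv p q y.
Hypothesis dh_exact : forall p q x, dh p q.+1 x = 0 -> exists y, x = dh p q y.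

Variables A B : cochain_complex K.
Variable epsA : forall q, {linear A q -> D 0 q}.
Variable epsB : forall p, {linear B p -> D p 0}.
Hypothesis epsA_inj : forall q, injective (epsA q).
Hypothesis epsB_inj : forall p, injective (epsB p).
Hypothesis epsA_diff : forall q a, epsA q.+1 (codiff A q a) = dh 0 q (epsA q a).
Hypothesis epsB_diff : forall p b, epsB p.+1 (codiff B p b) = dv p 0 (epsB p b).
Hypothesis epsA_ker : forall q x, dv 0 q x = 0 <-> exists a, x = epsA q a.
Hypothesis epsB_ker : forall p x, dh p 0 x = 0 <-> exists b, x = epsB p b.

Let bicocycle p q (x : D p q) := dv p q x = 0 /\ dh p q x = 0.

(** Cocycles for both differentials, modulo the image under one differential of
the kernel of the other one. In both cases that image comes from D p q, whence
the shift of the indices. *)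
Let vsq p q := @Subquotient K (D p.+1 q) (@bicocycle p.+1 q)
  (fun x => exists2 y, dh p q y = 0 & x = dv p q y).
Let hsq p q := @Subquotient K (D p q.+1) (@bicocycle p q.+1)
  (fun x => exists2 y, dv p q y = 0 & x = dh p q y).

(** One step of the staircase: the classes of dh u and dv u correspond. If
dh u = dh w with dv w = 0, then u - w is killed by dh and has the same image as
u under dv; so one side is trivial if and only if the other one is. *)
Lemma bicomplex_step p q : sq_iso (hsq p q) (vsq p q).
Proof.
exists (fun x y => exists u, [/\ dh p.+1 q (dv p q u) = 0, x = dh p q u & y = dv p q u]).
split.
- move=> a _ _ _ _ [u [u0 -> ->]] [v [v0 -> ->]].
  by exists (a *: u + v); rewrite !linearP u0 v0 scaler0 addr0.
- move=> _ _ [u [u0 -> ->]]; split; first by split; rewrite ?dhK // dvh.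
    by split; rewrite ?dvK.
  split=> [[w w0 uw]|[w w0 uw]]; exists (u - w);
    rewrite !linearB /= ?uw ?subrr ?w0 ?subr0 //.
- move=> x [xv /dh_exact[u xu]]; exists (dv p q u), u; split=> //.
  by rewrite -dvh -xu.
- move=> y [/dv_exact[u yu] yh]; exists (dh p q u), u; split=> //.
  by rewrite -yu.
Qed.

(** Away from the edges both kinds of boundaries are the elements dv (dh u), by
exactness in both directions. *)
Lemma bicomplex_exchange p q : sq_iso (vsq p q.+1) (hsq p.+1 q).
Proof.
exists (fun x y => x = y /\ bicocycle x); split.
- move=> a x y x' y' [<- [xv xh]] [<- [xv' xh']]; split=> //.
  by split; rewrite linearP ?xv ?xv' ?xh ?xh' scaler0 addr0.
- move=> x y0 [<- xN]; split=> //; split=> -[y].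
    by move=> /dh_exact[u ->] ->; exists (dv p q u); rewrite ?dvK // dvh.
  by move=> /dv_exact[u ->] ->; exists (dh p q u); rewrite ?dhK // dvh.
- by move=> x xN; exists x.
- by move=> x xN; exists x.
Qed.

Lemma bicomplex_staircase q p m : (p + q = m)%N -> sq_iso (hsq p q) (vsq m 0).
Proof.
elim: q p m => [|q IH] p m; first by rewrite addn0 => <-; apply: bicomplex_step.
rewrite addnS -addSn => /IH; apply: sq_iso_trans.
by apply: sq_iso_trans (bicomplex_exchange p q); apply: bicomplex_step.
Qed.

(** At the edge p = 0 the kernel of dv is the complex A, so that the subquotient
there is the cohomology of A; the edge q = 0 gives that of B in the same way. *)
Lemma hsq_cohomology q : sq_iso (cohomology_sq A q.+1) (hsq 0 q).
Proof.
exists (fun a x => x = epsA q.+1 a /\ codiff A q.+1 a = 0); split.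
- move=> c a a' _ _ [-> a0] [-> a0'].
  by rewrite !linearP a0 a0' scaler0 addr0.
- move=> a _ [-> a0]; split=> //.
    split; first by apply/epsA_ker; exists a.
    by rewrite -epsA_diff a0 linear0.
  split=> [[b ->]|[y /epsA_ker[b ->]]].
    by exists (epsA q b); rewrite ?epsA_diff //; apply/epsA_ker; exists b.
  by rewrite -epsA_diff => /epsA_inj ->; exists b.
- by move=> a a0; exists (epsA q.+1 a).
- move=> x [/epsA_ker[a ->]]; rewrite -epsA_diff => a0; exists a; split=> //.
  by apply: epsA_inj; rewrite linear0.
Qed.

Lemma vsq_cohomology p : sq_iso (cohomology_sq B p.+1) (vsq p 0).
Proof.
exists (fun b x => x = epsB p.+1 b /\ codiff B p.+1 b = 0); split.
- move=> c b b' _ _ [-> b0] [-> b0'].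
  by rewrite !linearP b0 b0' scaler0 addr0.
- move=> b _ [-> b0]; split=> //.
    split; last by apply/epsB_ker; exists b.
    by rewrite -epsB_diff b0 linear0.
  split=> [[c ->]|[y /epsB_ker[c ->]]].
    by exists (epsB p c); rewrite ?epsB_diff //; apply/epsB_ker; exists c.
  by rewrite -epsB_diff => /epsB_inj ->; exists c.
- by move=> b b0; exists (epsB p.+1 b).
- move=> x [xv /epsB_ker[b xb]]; exists b; split=> //.
  by apply: epsB_inj; rewrite linear0 epsB_diff -xb.
Qed.

Lemma cohomology0_sq_iso : sq_iso (cohomology_sq B 0) (cohomology_sq A 0).
Proof.
exists (fun b a => [/\ epsB 0 b = epsA 0 a, codiff B 0 b = 0 & codiff A 0 a = 0]).
split.
- move=> c b b' a a' [ba b0 a0] [ba' b0' a0'].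
  by rewrite !linearP ba ba' b0 b0' a0 a0' !scaler0 !addr0.
- move=> b a [ba b0 a0]; split=> //=; split=> E; move: ba; rewrite E linear0.
    by rewrite -(linear0 (epsA 0)) => /epsA_inj.
  by rewrite -(linear0 (epsB 0)) => /epsB_inj.
- move=> b b0; have /epsA_ker[a ba] : dv 0 0 (epsB 0 b) = 0.
    by rewrite -epsB_diff b0 linear0.
  exists a; split=> //; apply: epsA_inj; rewrite linear0 epsA_diff -ba.
  by apply/epsB_ker; exists b.
- move=> a a0; have /epsB_ker[b ab] : dh 0 0 (epsA 0 a) = 0.
    by rewrite -epsA_diff a0 linear0.
  exists b; split=> //; apply: epsB_inj; rewrite linear0 epsB_diff -ab.
  by apply/epsA_ker; exists a.
Qed.

(** Two complexes that are the edges of a double complex with exact rows and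
columns have the same cohomology. The squares commute instead of anticommuting,
which only changes the signs of the intermediate terms of the staircase. *)
Lemma balancing m : sq_iso (cohomology_sq B m) (cohomology_sq A m).
Proof.
case: m => [|m]; first exact: cohomology0_sq_iso.
apply: sq_iso_trans (vsq_cohomology m) _; apply: sq_iso_sym.
by apply: sq_iso_trans (hsq_cohomology m) _; apply: bicomplex_staircase.
Qed.

End Balancing.

(** * Cochains with coinduced coefficients *)

Section Coinduced.
Variables (gT : finGroupType) (K : fieldType) (U : lmodType K).

Definition coind_act_fun (g : gT) (m : {ffun gT -> U}) : {ffun gT -> U} :=
  [ffun x => m (x * g)%g].

Lemma coind_act_linear g : linear (coind_act_fun g).
Proof. by move=> a m m'; apply/ffunP => x; rewrite !ffunE. Qed.
HB.instance Definition _ g := GRing.isLinear.Build K {ffun gT -> U} {ffun gT -> U} _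
  (coind_act_fun g) (coind_act_linear g).

Lemma coind_act1 m : coind_act_fun 1%g m = m.
Proof. by apply/ffunP => x; rewrite ffunE mulg1. Qed.

Lemma coind_actM g h m : coind_act_fun (g * h)%g m = coind_act_fun g (coind_act_fun h m).
Proof. by apply/ffunP => x; rewrite !ffunE mulgA. Qed.

(** Coinduction from the trivial subgroup. Translating the argument on the right
is what makes this a left action. *)
Definition coind : gmodule gT K :=
  @GModule gT K {ffun gT -> U} (fun g => coind_act_fun g : {linear _ -> _})
    coind_act1 coind_actM.

Definition ffun_cons i (x : gT) (g : {ffun 'I_i -> gT}) : {ffun 'I_i.+1 -> gT} :=
  [ffun j => oapp g x (unlift ord0 j)].

Lemma ffun_cons0 i x (g : {ffun 'I_i -> gT}) : ffun_cons x g ord0 = x.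
Proof. by rewrite ffunE unlift_none. Qed.

Lemma ffun_cons_inord0 i x (g : {ffun 'I_i -> gT}) : ffun_cons x g (inord 0) = x.
Proof. by rewrite -[RHS](ffun_cons0 x g); congr (ffun_cons _ _ _); apply/val_inj; rewrite /= inordK. Qed.

Lemma ffun_consS i x (g : {ffun 'I_i -> gT}) l : ffun_cons x g (lift ord0 l) = g l.
Proof. by rewrite ffunE liftK. Qed.

Lemma ffun_cons_inordS i x (g : {ffun 'I_i.+1 -> gT}) l :
  (l < i.+1)%N -> ffun_cons x g (inord l.+1) = g (inord l).
Proof.
move=> li; rewrite -[RHS](ffun_consS x g); congr (ffun_cons _ _ _).
by apply/val_inj; rewrite /= /bump !inordK // ltnW.
Qed.

Lemma face0_cons i x (g : {ffun 'I_i -> gT}) : face 0 (ffun_cons x g) = g.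
Proof.
apply/ffunP => l; rewrite ffunE /=.
by rewrite -[RHS](ffun_consS x g); congr (ffun_cons _ _ _); apply/val_inj; rewrite /= inordK ?ltnS.
Qed.

Lemma face1_cons i x (g : {ffun 'I_i.+1 -> gT}) :
  face 1 (ffun_cons x g) = ffun_cons (x * g ord0)%g (face 0 g).
Proof.
have g0 : g (inord 0) = g ord0 by congr (g _); apply/val_inj; rewrite /= inordK.
apply/ffunP => l; rewrite [LHS]ffunE; case: (unliftP ord0 l) => [l'|] ->.
  rewrite ffun_consS [RHS]ffunE /= /bump /= add1n ffun_cons_inordS //.
    exact: ltn_ord l'.
by rewrite ffun_cons0 /= ffun_cons_inord0 ffun_cons_inordS // g0.
Qed.

Lemma faceS_cons i j x (g : {ffun 'I_i.+1 -> gT}) :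
  face j.+2 (ffun_cons x g) = ffun_cons x (face j.+1 g).
Proof.
apply/ffunP => l; rewrite [LHS]ffunE; case: (unliftP ord0 l) => [l'|] ->.
  rewrite ffun_consS [RHS]ffunE /= /bump /= add1n !ltnS eqSS.
  have li : (l'.+1 < i.+1)%N := ltn_ord l'.
  by rewrite !ffun_cons_inordS ?(ltnW li).
by rewrite ffun_cons0 /= ffun_cons_inord0.
Qed.

(** The contracting homotopy of a coinduced module feeds the argument of the
value to the cochain as an additional first group element. *)
Lemma coind_codiff_homotopy i (f : group_cochain coind i.+1) x g :
  codiff (group_complex coind) i.+1 f (ffun_cons x g) 1%g =
  f g x - codiff (group_complex coind) i [ffun h => [ffun y => f (ffun_cons y h) 1%g]] g x.
Proof.
rewrite /= !ffunE !sum_ffunE big_ord_recl /= scale1r /coface /= face0_cons.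
rewrite !ffunE mul1g unlift_none -sumrN; congr (_ + _).
rewrite big_ord_recl [in RHS]big_ord_recl /bump /=; congr (_ + _).
  by rewrite !ffunE face1_cons scale1r expr1 scaleN1r.
apply: eq_bigr => j _; rewrite !ffunE faceS_cons.
by rewrite !add1n exprS mulN1r scaleNr.
Qed.

Lemma coind_codiff_exact i (f : group_cochain coind i.+1) :
  codiff (group_complex coind) i.+1 f = 0 ->
  exists y, f = codiff (group_complex coind) i y.
Proof.
move=> f0; exists [ffun h => [ffun y => f (ffun_cons y h) 1%g]].
apply/ffunP => g; apply/ffunP => x; apply/eqP; rewrite -subr_eq0.
by rewrite -coind_codiff_homotopy f0 !ffunE.
Qed.

Lemma group_codiff0E (M : gmodule gT K) (f : group_cochain M 0) g :
  codiff (group_complex M) 0 f g = Defs.gact M (g ord0) (f (face 0 g)) - f (face 1 g).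
Proof.
by rewrite /= ffunE !big_ord_recl big_ord0 /= addr0 scale1r expr1 scaleN1r.
Qed.

Lemma coind_codiff0_ker (f : group_cochain coind 0) :
  codiff (group_complex coind) 0 f = 0 <->
  exists u, f = [ffun _ => [ffun _ => u]].
Proof.
have ff0 (h h' : {ffun 'I_0 -> gT}) : h = h' by apply/ffunP => -[].
split=> [f0|[u ->]].
  exists (f [ffun _ => 1%g] 1%g); apply/ffunP => h; apply/ffunP => x; rewrite !ffunE.
  have := group_codiff0E f [ffun _ => x].
  rewrite f0 => /(congr1 (fun m : {ffun gT -> U} => m 1%g)).
  rewrite !ffunE mul1g => /esym/eqP; rewrite subr_eq0 => /eqP.
  by rewrite (ff0 (face 0 _) h) (ff0 (face 1 _) [ffun=> 1%g]).
by apply/ffunP => g; rewrite group_codiff0E; apply/ffunP => x; rewrite !ffunE subrr.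
Qed.

End Coinduced.

Section EquivariantCochains.
Variables (gT : finGroupType) (K : fieldType) (M M' : gmodule gT K).
Variable h : {linear M -> M'}.
Hypothesis hG : forall g m, h (Defs.gact M g m) = Defs.gact M' g (h m).

Definition cochain_map p (f : group_cochain M p) : group_cochain M' p :=
  [ffun g => h (f g)].

Lemma cochain_map_linear p : linear (@cochain_map p).
Proof. by move=> a x y; apply/ffunP => g; rewrite !ffunE linearP. Qed.
HB.instance Definition _ p := GRing.isLinear.Build K (group_cochain M p)
  (group_cochain M' p) _ (@cochain_map p) (@cochain_map_linear p).

Lemma cochain_map_codiff p (f : group_cochain M p) :
  codiff (group_complex M') p (cochain_map f) = cochain_map (codiff (group_complex M) p f).
Proof.
apply/ffunP => g; rewrite /= !ffunE linear_sum; apply: eq_bigr => j _.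
by rewrite linearZ /coface; case: ifP => _; rewrite !ffunE ?hG.
Qed.
End EquivariantCochains.

(** * The top exterior power *)

Section FactorLinear.
Variables (K : fieldType) (X Y Z : vectType K).

Lemma lfun_factor (a : 'Hom(X, Y)) (f : 'Hom(X, Z)) x :
  (lker a <= lker f)%VS -> f ((a^-1)%VF (a x)) = f x.
Proof.
move=> /subvP kaf; apply/eqP; rewrite -subr_eq0 -linearB -memv_ker kaf //.
by rewrite memv_ker linearB /= limg_lfunVK ?subrr ?memv_img ?memvf.
Qed.

(** A linear map f extends along a, with value zero on U, as soon as it kills the
inverse image of U: project the target onto a complement of U; then f factors
through the projected a. *)
Lemma lfun_extend (a : 'Hom(X, Y)) (U : {vspace Y}) (f : 'Hom(X, Z)) :
  (forall x, a x \in U -> f x = 0) ->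
  exists g : 'Hom(Y, Z), (forall x, g (a x) = f x) /\ (forall u, u \in U -> g u = 0).
Proof.
move=> aUf; pose p : 'End(Y) := (\1 - projv U)%VF.
have pU y : (p y == 0) = (y \in U).
  rewrite add_lfunE opp_lfunE id_lfunE subr_eq0; apply/eqP/idP => [->|yU]; last by rewrite projv_id.
  by rewrite memv_proj.
exists (f \o (p \o a)^-1 \o p)%VF; split=> [x|u uU].
  rewrite !comp_lfunE -[p (a x)]comp_lfunE lfun_factor //.
  by apply/subvP => y; rewrite !memv_ker comp_lfunE pU => /aUf ->.
by rewrite !comp_lfunE; move: uU; rewrite -pU => /eqP ->; rewrite !linear0.
Qed.
End FactorLinear.

Section Wedge.
Variables (k : finFieldType) (m : nat) (V : vectType k).
Implicit Type v : vtuple m V.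

Lemma vupdate_id v i : vupdate v i (v i) = v.
Proof. by apply/ffunP => j; rewrite ffunE; case: eqP => // ->. Qed.

Lemma vupdate_comm v i j x y : i != j ->
  vupdate (vupdate v i x) j y = vupdate (vupdate v j y) i x.
Proof.
move=> ij; apply/ffunP => l; rewrite !ffunE.
by case: (l =P i) => // ->; rewrite (negPf ij).
Qed.

Lemma wedge_eq0 v : ~~ injectiveb v -> wedge v = 0.
Proof.
move=> vN; apply/eqP; rewrite -(linear0 (vect_quot_pi (ext_rel m V))).
rewrite vect_quot_pi_eq subr0; apply: (subvP (addvSr _ _)).
exact: mem_alternating_rel.
Qed.

Definition wedge_at v i (x : V) : ext_power m V := wedge (vupdate v i x).

Lemma wedge_at_linear v i : linear (wedge_at v i).
Proof.
move=> a x y; rewrite /wedge_at /wedge -linearP; apply/eqP; rewrite vect_quot_pi_eq.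
rewrite opprD addrA; apply: (subvP (addvSl _ _)); exact: mem_multilinear_rel.
Qed.
HB.instance Definition _ v i := GRing.isLinear.Build k V (ext_power m V) _
  (wedge_at v i) (wedge_at_linear v i).

(** Expand the wedge with v i + v j at both positions i and j, which vanishes. *)
Lemma wedge_swap v i j : i != j ->
  wedge ([ffun l => v (tperm i j l)] : vtuple m V) = - wedge v.
Proof.
move=> ij; pose U x y := vupdate (vupdate v i x) j y.
have UE x y : wedge (U x y) = wedge_at (vupdate v i x) j y by [].
have UE' x y : wedge (U x y) = wedge_at (vupdate v j y) i x.
  by rewrite /U vupdate_comm.
have U0 x : wedge (U x x) = 0.
  apply: wedge_eq0; apply/negP => /injectiveP/(_ i j).
  rewrite !ffunE !eqxx (negPf ij) => /(_ erefl) ij'.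
  by move: ij; rewrite ij' eqxx.
have -> : [ffun l => v (tperm i j l)] = U (v j) (v i).
  apply/ffunP => l; rewrite !ffunE; case: tpermP => [->|->|/eqP/negPf -> /eqP/negPf ->] //.
    by rewrite (negPf ij) eqxx.
  by rewrite eqxx.
have vE : U (v i) (v j) = v by rewrite /U !vupdate_id.
rewrite -[X in - wedge X]vE.
apply/eqP; rewrite -addr_eq0; apply/eqP.
have := U0 (v i + v j).
rewrite UE linearD /= -!UE !UE' !linearD /= -!UE' !U0 add0r addr0 => <-.
by rewrite addrC.
Qed.

Lemma wedge_perm v (s : {perm 'I_m}) :
  wedge ([ffun l => v (s l)] : vtuple m V) \in <[wedge v]>%VS.
Proof.
have [ts -> _] := prod_tpermP s; elim: ts v => [|[i j] ts IH] v.
  rewrite big_nil; have -> : [ffun l => v ((1%g : {perm _}) l)] = v.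
    by apply/ffunP => l; rewrite ffunE perm1.
  exact: memv_line.
rewrite big_cons /=; set t := (\prod_(_ <- ts) _)%g in IH *.
have -> : [ffun l => v ((tperm i j * t)%g l)] =
   [ffun l => ([ffun l => v (t l)] : vtuple m V) (tperm i j l)] :> vtuple m V.
  by apply/ffunP => l; rewrite !ffunE permM.
have [<-|ij] := eqVneq i j; last by rewrite wedge_swap // rpredN.
rewrite tperm1; have -> : [ffun l => ([ffun l => v (t l)] : vtuple m V) ((1%g : {perm _}) l)] =
   [ffun l => v (t l)] :> vtuple m V.
  by apply/ffunP => l; rewrite !ffunE perm1.
exact: IH.
Qed.
End Wedge.

Section TopPower.
Variables (k : finFieldType) (n : nat).
Local Notation V := ('rV[k]_n).
Local Notation vtuple := (vtuple n V).

Definition vtuple_mx (v : vtuple) : 'M[k]_n := \matrix_(i, j) (v i : V) 0 j.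

Definition std_vtuple : vtuple := [ffun i => delta_mx 0 i : V].

Lemma wedge_std_line (v : vtuple) : wedge v \in <[wedge std_vtuple]>%VS.
Proof.
(* Induction on the number of positions not known to hold basis vectors. *)
suff H r : forall v : vtuple, (forall i : 'I_n, (r <= i)%N -> exists j, v i = std_vtuple j) ->
    wedge v \in <[wedge std_vtuple]>%VS.
  by apply: (H n) => i; rewrite leqNgt ltn_ord.
elim: r => [|r IH] {}v vb.
  have [s sP] := choice (fun i => vb i (leq0n i)).
  have [vi|/wedge_eq0 ->] := boolP (injectiveb v); last exact: mem0v.
  have si : injective s by move=> i j sij; apply: (injectiveP _ vi); rewrite !sP sij.
  suff -> : v = [ffun l => std_vtuple (perm si l)] by apply: wedge_perm.
  by apply/ffunP => l; rewrite [RHS]ffunE permE sP.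
have [rn|rn] := ltnP r n; last first.
  by apply: IH => i ri; have := leq_trans rn ri; rewrite leqNgt ltn_ord.
pose i := Ordinal rn; rewrite -(vupdate_id v i) [v i : V]row_sum_delta.
rewrite -[wedge _]/(wedge_at v i _) linear_sum; apply: rpred_sum => j _.
rewrite linearZ rpredZ //; apply: IH => l rl; rewrite ffunE.
have [_|li] := eqVneq l i; first by exists j; rewrite ffunE.
apply: vb; rewrite ltn_neqAle rl andbT; apply: contra li => /eqP rl'.
by apply/eqP/val_inj.
Qed.

Lemma ext_power_top_line (q : ext_power n V) : q \in <[wedge std_vtuple]>%VS.
Proof.
have id_proj : (\1 : 'End(ext_power n V))%VF = projv <[wedge std_vtuple]>%VS.
  by apply: wedge_spanP => v; rewrite id_lfunE projv_id // wedge_std_line.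
by rewrite -[q](id_lfunE) id_proj memv_proj.
Qed.

Lemma std_vtuple_mx : vtuple_mx std_vtuple = 1%:M.
Proof. by apply/matrixP => i j; rewrite !mxE !ffunE !mxE eq_sym. Qed.

(** The determinant respects the relations defining the exterior power, hence
gives a linear form on it; the form is injective since the wedge of the standard
basis spans and has determinant 1. *)
Lemma wedge_det : exists D : 'Hom(ext_power n V, k^o),
  (forall v, D (wedge v) = \det (vtuple_mx v)) /\ lker D = 0%VS.
Proof.
pose d (phi : formal_tensor n V) : k^o := \sum_(v : vtuple) phi v * \det (vtuple_mx v).
have dlin : linear d.
  move=> a x y; rewrite /d scaler_sumr -big_split /=; apply: eq_bigr => v _.
  by rewrite !ffunE mulrDl -scalerAl.
pose dL : 'Hom(formal_tensor n V, k^o) := linfun (HB.pack d (GRing.isLinear.Build _ _ _ _ d dlin) : {linear _ -> _}).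
have dE v : dL (ftensor v) = \det (vtuple_mx v).
  rewrite lfunE /= /d (bigD1 v) //= ffunE eqxx mul1r big1 ?addr0 // => u /negPf uv.
  by rewrite ffunE uv mul0r.
have dker : (ext_rel n V <= lker dL)%VS.
  rewrite subv_add; apply/andP; split.
    apply/subv_sumP => v _; apply/subv_sumP => i _; apply/subv_sumP => a _.
    apply/subv_sumP => x _; apply/subv_sumP => y _.
    rewrite -memvE memv_ker !linearB linearZ /= !dE.
    rewrite (@determinant_multilinear _ _ _ (vtuple_mx (vupdate v i x))
      (vtuple_mx (vupdate v i y)) i a 1) ?mul1r.
    + by rewrite addrAC addrK subr_eq0; apply/eqP.
    + by apply/rowP => j; rewrite !mxE !ffunE !eqxx !mxE mul1r.
    + by apply/matrixP => j l; rewrite !mxE !ffunE eq_sym (negPf (neq_lift _ _)).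
    + by apply/matrixP => j l; rewrite !mxE !ffunE eq_sym (negPf (neq_lift _ _)).
  apply/subv_sumP => v vN; rewrite -memvE memv_ker dE; apply/eqP.
  have /injectivePn[i [j ij vij]] := vN.
  by apply: (determinant_alternate ij) => l; rewrite !mxE vij.
pose pi : 'Hom(formal_tensor n V, ext_power n V) := linfun (vect_quot_pi (ext_rel n V)).
have piE v : pi (ftensor v) = wedge v by rewrite lfunE.
have piker : (lker pi <= lker dL)%VS.
  apply: subv_trans dker; apply/subvP => x; rewrite memv_ker lfunE /=.
  by rewrite -(linear0 (vect_quot_pi (ext_rel n V))) vect_quot_pi_eq subr0.
pose D : 'Hom(ext_power n V, k^o) := (dL \o pi^-1)%VF.
have DE v : D (wedge v) = \det (vtuple_mx v).
  by rewrite comp_lfunE -piE lfun_factor // dE.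
exists D; split=> //; apply/eqP; rewrite -subv0; apply/subvP => q.
rewrite memv_ker => /eqP Dq0.
have /vlineP[c qE] := ext_power_top_line q.
move: Dq0; rewrite qE linearZ /= DE std_vtuple_mx det1.
by move=> /eqP; rewrite scaler_eq0 oner_eq0 orbF => /eqP ->; rewrite scale0r mem0v.
Qed.
End TopPower.

(** * Acyclicity of the singular part of the standard resolution *)

Section SupportAcyclic.
Variables (k : finFieldType) (n : nat).
Local Notation std := (vect_std k n).
Local Notation End := (@free_hom k n std).
Implicit Types F G : vfunctor k n.
Implicit Type X : {set End}.

Definition right_ideal X := forall f g : 'End(std), (f : End) \in X -> ((f \o g)%VF : End) \in X.

Definition supported F X (phi : free_functor F std) :=
  forall f : End, f \notin X -> phi f = 0.

Definition principal (f : 'End(std)) : {set End} := [set h : End | [exists g : End, (f \o g)%VF == h]].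

Lemma principalP (f h : 'End(std)) : reflect (exists g : 'End(std), h = (f \o g)%VF) ((h : End) \in principal f).
Proof.
rewrite inE; apply: (iffP existsP) => -[g]; first by move=> /eqP <-; exists g.
by move=> ->; exists g; apply: eqxx.
Qed.

Lemma principal_ideal f : right_ideal (principal f).
Proof. by move=> h g /principalP[u ->]; apply/principalP; exists (u \o g)%VF; rewrite comp_lfunA. Qed.

Lemma principal_id (f : 'End(std)) : (f : End) \in principal f.
Proof. by apply/principalP; exists \1%VF; rewrite comp_lfun1r. Qed.

Lemma principal_sub X (f : 'End(std)) : right_ideal X -> (f : End) \in X -> principal f \subset X.
Proof. by move=> Xr fX; apply/subsetP => h /principalP[g ->]; apply: Xr. Qed.

Lemma supported0 F X : supported X (0 : free_functor F std).
Proof. by move=> f _; rewrite ffunE. Qed.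

Lemma supportedD F X (a b : free_functor F std) :
  supported X a -> supported X b -> supported X (a + b).
Proof. by move=> aX bX f fX; rewrite ffunE aX ?bX ?addr0. Qed.

Lemma supportedN F X (a : free_functor F std) : supported X a -> supported X (- a).
Proof. by move=> aX f fX; rewrite ffunE aX ?oppr0. Qed.

Lemma supportedS F X X' (a : free_functor F std) :
  X \subset X' -> supported X a -> supported X' a.
Proof. by move=> /subsetP XX' aX f fX'; apply: aX; apply: contra fX' => /XX'. Qed.

Lemma supportedI F X X' (a : free_functor F std) :
  supported X a -> supported X' a -> supported (X :&: X') a.
Proof. by move=> aX aX' f; rewrite inE negb_and => /orP[/aX|/aX']. Qed.

Lemma supported_sum F X (I : Type) (s : seq I) (P : pred I) (a : I -> free_functor F std) :
  (forall i, P i -> supported X (a i)) -> supported X (\sum_(i <- s | P i) a i).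
Proof.
move=> aX; elim/big_rec: _ => [|i x Pi xX]; first exact: supported0.
by apply: supportedD => //; apply: aX.
Qed.

Lemma fmap_supported F X (f : 'End(std)) (phi : free_functor F std) :
  right_ideal X -> (f : End) \in X -> supported X (fmap (free_functor F) f phi).
Proof.
move=> Xr fX h hX; rewrite /= free_mapE big1 // => u /eqP fu.
by move: hX; rewrite -fu Xr.
Qed.

Lemma free_single0 F (V : vect_le k n) f : free_single f (0 : F std) = 0 :> free_functor F V.
Proof. by apply/ffunP => h; rewrite !ffunE if_same. Qed.

Lemma free_singleE F (V : vect_le k n) (f : 'Hom(std, V)) x :
  free_single f x = fmap (free_functor F) f (free_single (\1%VF : 'End(std)) x).
Proof. by rewrite fmap_free_single comp_lfun1r. Qed.

Lemma nt_supported F G X (a : nattrans (free_functor F) (free_functor G)) phi :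
  right_ideal X -> supported X phi -> supported X (a std phi).
Proof.
move=> Xr phiX; rewrite [phi]free_single_sum linear_sum /=.
apply: supported_sum => f _; have [fX|fX] := boolP (f \in X); last first.
  by rewrite phiX // free_single0 linear0; apply: supported0.
by rewrite free_singleE (nt_naturalE a); apply: fmap_supported.
Qed.

Lemma fmap_idem_supported F (e : 'End(std)) (phi : free_functor F std) :
  (e \o e)%VF = e -> supported (principal e) phi -> fmap (free_functor F) e phi = phi.
Proof.
move=> ee phie; rewrite [in RHS](free_single_sum phi) [in LHS](free_single_sum phi) linear_sum /=.
apply: eq_bigr => f _; rewrite fmap_free_single.
have [/principalP[g fg]|fX] := boolP (f \in principal e); last by rewrite phie // !free_single0.
by congr (free_single _ _); rewrite [f]fg comp_lfunA ee.
Qed.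

Variable F : vfunctor k n.

(** With e = f f^-1 for a pseudo-inverse of f, the right ideals generated by f
and by the idempotent e coincide, and e fixes whatever is supported on them. Any
primitive y of a cycle z can therefore be replaced by e y, as e z = z. *)
Lemma std_res_acyclic_principal (f : 'End(std)) q (z : std_res_obj F q std) :
  supported (principal f) z -> free_aug (syzygy F q) std z = 0 ->
  exists2 y : std_res_obj F q.+1 std, supported (principal f) y & std_res_diff F q std y = z.
Proof.
pose e := (f \o f^-1)%VF.
have ef : (e \o f)%VF = f.
  apply/lfunP => x; rewrite comp_lfunE comp_lfunE limg_lfunVK //.
  exact: memv_img (memvf x).
have ee : (e \o e)%VF = e by rewrite {2}/e comp_lfunA ef.
have -> : principal f = principal e.
  apply/eqP; rewrite eqEsubset; apply/andP; split.
    by apply: principal_sub (@principal_ideal e) _; apply/principalP; exists f.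
  by apply: principal_sub (@principal_ideal f) _; apply/principalP; exists (f^-1)%VF.
move=> zX z0; have : z \in limg (std_res_diff F q std) by rewrite limg_std_res_diff memv_ker z0.
case/memv_imgP => y _ zy; exists (fmap (std_res_obj F q.+1) e y).
  by apply: fmap_supported; [apply: principal_ideal | apply: principal_id].
by rewrite nt_naturalE -zy; apply: fmap_idem_supported.
Qed.

(** Mayer-Vietoris. For f in X generating a maximal principal right ideal f E,
let X' be the set of those g in X with f not in g E; it is a right ideal not
containing f, and X is the union of X' and f E. Split a cycle as z = z' + w along
this union. The boundaries of z' and - w agree, hence are supported on the
intersection of X' and f E, where they bound some u by induction; now z' - u and
w + u are cycles supported on X' and on f E. In degree 0 there is only
the augmentation to F below z', and u = 0 will do because the elements of X act by
zero on F. *)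
Lemma std_res_acyclic X : right_ideal X ->
  (forall f : 'End(std), (f : End) \in X -> fmap F f = 0) ->
  forall q (z : std_res_obj F q std), supported X z -> free_aug (syzygy F q) std z = 0 ->
  exists2 y : std_res_obj F q.+1 std, supported X y & std_res_diff F q std y = z.
Proof.
have [m] := ubnP #|X|; elim: m X => // m IH X /ltnSE Xm Xr XF q z zX z0.
have [X0|[f0 f0X]] := set_0Vmem X.
  exists 0; first exact: supported0.
  by rewrite linear0; apply/ffunP => f; rewrite zX ?X0 ?inE // ffunE.
pose f := [arg max_(f > f0 in X) #|principal f|].
have [fX fmax] : f \in X /\ forall g : End, g \in X -> (#|principal g| <= #|principal f|)%N.
  by rewrite /f; case: arg_maxnP => // g.
have [Xf|Xf] := eqVneq X (principal f).
  by rewrite Xf in zX *; apply: std_res_acyclic_principal.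
have fsX : principal f \subset X by apply: principal_sub.
pose X' := [set g in X | f \notin principal g].
have X'r : right_ideal X'.
  move=> g h; rewrite !inE => /andP[gX]; rewrite Xr //=; apply: contra.
  case/existsP => u /eqP fu; apply/existsP; exists ((h \o u)%VF); apply/eqP.
  by rewrite -fu comp_lfunA.
have X'X : X' \subset X by apply/subsetP => g; rewrite inE => /andP[].
have X'lt : (#|X'| < m)%N.
  apply: leq_trans Xm; apply: proper_card; apply/properP; split=> //.
  by exists f => //; rewrite inE principal_id andbF.
(* If f lies in h E, then f E is contained in h E, and equality follows by
   maximality. *)
have XU h : h \in X -> h \notin X' -> h \in principal f.
  move=> hX; rewrite inE hX /= negbK => fh.
  have /eqP -> : principal f == principal h.
    by rewrite eqEcard fmax // andbT principal_sub //; apply: (@principal_ideal h).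
  exact: principal_id.
pose z' : std_res_obj F q std := [ffun h : End => if h \in X' then z h else 0].
have z'X : supported X' z' by move=> h /negPf hX; rewrite ffunE hX.
have wX : supported (principal f) (z - z').
  move=> h hf; rewrite !ffunE; case: ifP => hX'; rewrite ?subrr // subr0 zX //.
  by apply: contra hf => hX; apply: XU => //; rewrite hX'.
have Ir : right_ideal (X' :&: principal f).
  move=> g h; rewrite !in_setI => /andP[gX gf]; apply/andP; split; first exact: X'r.
  exact: (@principal_ideal f).
have Ilt : (#|X' :&: principal f| < m)%N.
  by apply: leq_ltn_trans X'lt; rewrite subset_leq_card ?subsetIl.
have wE : free_aug (syzygy F q) std (z - z') = - free_aug (syzygy F q) std z'.
  by rewrite linearB /= z0 sub0r.
(* Exactness one degree lower, for the intersection, provides u. *)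
have [u uI uE] : exists2 u : std_res_obj F q std, supported (X' :&: principal f) u
    & free_aug (syzygy F q) std u = free_aug (syzygy F q) std z'.
  case: q z z0 zX z' z'X wX wE => [|q] z z0 zX z' z'X wX wE.
    exists 0; first exact: supported0.
    rewrite linear0 [RHS]lfunE /= /free_aug_fun big1 // => g _.
    have [gX|gX] := boolP (g \in X'); last by rewrite z'X // linear0.
    by rewrite XF ?zero_lfunE //; apply: (subsetP X'X).
  have tI : supported (X' :&: principal f) (std_res_diff F q std z').
    apply: supportedI; first exact: nt_supported.
    have -> : std_res_diff F q std z' = - std_res_diff F q std (z - z').
      by rewrite /= !comp_lfunE wE linearN /= opprK.
    by apply: supportedN; apply: nt_supported => //; apply: principal_ideal.
  have t0 : free_aug (syzygy F q) std (std_res_diff F q std z') = 0.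
    by apply/eqP; rewrite -memv_ker -limg_std_res_diff memv_img ?memvf.
  have [g gI|u uI uE] := IH _ Ilt Ir _ q _ tI t0.
    by apply: XF; apply: (subsetP X'X); move: gI; rewrite inE => /andP[].
  exists u => //; apply/eqP; rewrite -subr_eq0 -linearB -memv0.
  rewrite -(lker_ker_incl (free_aug (syzygy F q)) std) memv_ker.
  by rewrite -comp_lfunE linearB subr_eq0; apply/eqP.
have [g gX'|||y yX' yE] := IH _ X'lt X'r _ q (z' - u).
- by apply: XF; apply: (subsetP X'X).
- apply: supportedD => //; apply: supportedN; exact: supportedS (subsetIl _ _) uI.
- by rewrite linearB /= uE subrr.
have [||y' y'f y'E] := @std_res_acyclic_principal f q (z - z' + u).
- by apply: supportedD => //; exact: supportedS (subsetIr _ _) uI.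
- by rewrite linearD /= wE uE addNr.
exists (y + y'); last by rewrite linearD /= yE y'E addrC addrA addrAC addrK addrNK.
by apply: supportedD; [apply: supportedS X'X _ | apply: supportedS fsX _].
Qed.

End SupportAcyclic.

(** * Natural transformations out of a free functor *)

Section TransOfLinear.
Variables (k : finFieldType) (n : nat) (F G : vfunctor k n).
Local Notation std := (vect_std k n).
Variable u : 'Hom(F std, G std).

Definition free_trans_fun (V : vect_le k n) (phi : free_functor F V) : G V :=
  \sum_(f : free_hom V) fmap G f (u (phi f)).

Lemma free_trans_linear V : linear (@free_trans_fun V).
Proof.
move=> a x y; rewrite /free_trans_fun scaler_sumr -big_split /=.
by apply: eq_bigr => f _; rewrite !ffunE !linearP.
Qed.
HB.instance Definition _ V := GRing.isLinear.Build k (free_functor F V) (G V) _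
  (@free_trans_fun V) (@free_trans_linear V).

Definition free_trans_app (V : vect_le k n) : 'Hom(free_functor F V, G V) :=
  linfun (@free_trans_fun V).

Lemma free_trans_app_single (V : vect_le k n) (f : 'Hom(std, V)) x :
  free_trans_app V (free_single f x) = fmap G f (u x).
Proof.
rewrite lfunE /= /free_trans_fun (bigD1 (f : free_hom V)) //= ffunE eqxx.
by rewrite big1 ?addr0 // => h /negPf ne; rewrite ffunE ne !linear0.
Qed.

Lemma free_trans_natural (V W : vect_le k n) (h : 'Hom(V, W)) :
  (free_trans_app W \o fmap (free_functor F) h)%VF = (fmap G h \o free_trans_app V)%VF.
Proof.
apply/lfunP => phi; rewrite !comp_lfunE (free_single_sum phi) !linear_sum /=.
by apply: eq_bigr => f _; rewrite fmap_free_single !free_trans_app_single fmap_compE.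
Qed.

Definition free_trans : nattrans (free_functor F) G := NatTrans free_trans_natural.
End TransOfLinear.

(** * The general linear group inside the endomorphisms *)

Section GLPart.
Variables (k : finFieldType) (n' : nat).
Local Notation n := n'.+1.
Local Notation std := (vect_std k n).
Local Notation End := (@free_hom k n std).
Local Notation gT := {'GL_n[k]}.
Local Notation L := (exterior_functor k n n).

(** GL_n acts on row vectors on the right, so rho reverses products; this makes
rho (x * g) = rho g \o rho x match the action on coinduced modules. *)
Definition rho (x : gT) : 'End(std) := linfun (mulmxr (GLval x) : 'rV[k]_n -> 'rV[k]_n).

Lemma rhoE x (v : 'rV[k]_n) : rho x v = v *m GLval x.
Proof. by rewrite lfunE. Qed.

Lemma rhoM x y : rho (x * y)%g = (rho y \o rho x)%VF.
Proof. by apply/lfunP => v; rewrite comp_lfunE !rhoE GL_ME mulmxA. Qed.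

Lemma rho1 : rho 1%g = \1%VF.
Proof. by apply/lfunP => v; rewrite id_lfunE rhoE GL_1E mulmx1. Qed.

Definition end_mx (f : 'End(std)) : 'M[k]_n := lin1_mx (f : 'rV[k]_n -> 'rV[k]_n).

Lemma end_mxE (f : 'End(std)) (v : 'rV[k]_n) : v *m end_mx f = f v.
Proof. exact: mul_rV_lin1. Qed.

Lemma end_mx_comp (f g : 'End(std)) : end_mx (f \o g)%VF = end_mx g *m end_mx f.
Proof.
by apply/row_matrixP => i; rewrite !rowE mulmxA !end_mxE; apply: comp_lfunE.
Qed.

Lemma end_mx_rho x : end_mx (rho x) = GLval x.
Proof. by apply/row_matrixP => i; rewrite !rowE end_mxE rhoE. Qed.

Definition singular : {set End} := [set f : End | \det (end_mx f) == 0].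

Lemma singular_ideal : right_ideal singular.
Proof.
by move=> f g; rewrite !inE end_mx_comp det_mulmx => /eqP ->; rewrite mulr0.
Qed.

Lemma rho_nonsingular x : (rho x : End) \notin singular.
Proof.
rewrite inE end_mx_rho.
by have := GL_unitmx x; rewrite unitmxE unitfE.
Qed.

Lemma nonsingular_rho (f : 'End(std)) : (f : End) \notin singular -> exists x, f = rho x.
Proof.
rewrite inE => f0; have fU : end_mx f \is a GRing.unit by rewrite -unitfE in f0.
exists (FinRing.unit _ fU); apply/lfunP => v.
by rewrite rhoE /= end_mxE.
Qed.

Lemma rho_inj : injective rho.
Proof.
move=> x y /lfunP xy; apply/val_inj/row_matrixP => i.
by rewrite !rowE -!rhoE xy.
Qed.

(** The determinant detects the top wedges, and that of the images under f of n
vectors is a multiple of det f. *)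
Lemma exterior_singular (f : 'End(std)) : (f : End) \in singular -> fmap L f = 0.
Proof.
rewrite inE => /eqP f0; have [D [DE D0]] := wedge_det k n.
apply: wedge_spanP => v; rewrite zero_lfunE ext_power_mapE; apply/eqP.
rewrite -memv0 -D0 memv_ker DE.
have -> : vtuple_mx (vtuple_map f v) = vtuple_mx v *m end_mx f.
  apply/row_matrixP => i; rewrite row_mul end_mxE; apply/rowP => j.
  rewrite !mxE ffunE; congr ((f _ : 'rV[k]_n) _ _).
  by apply/rowP => l; rewrite !mxE.
by rewrite det_mulmx f0 mulr0.
Qed.

Lemma exterior_scalar (u : 'End(L std)) : exists c, u = c *: \1%VF.
Proof.
have /vlineP[c uc] := ext_power_top_line (u (wedge (std_vtuple k n))).
exists c; apply: wedge_spanP => v; have /vlineP[b ->] := wedge_std_line v.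
by rewrite scale_lfunE id_lfunE linearZ /= [u _]uc scalerA mulrC -scalerA.
Qed.

Lemma exterior_id_neq0 : (\1 : 'End(L std))%VF != 0.
Proof.
have [D [DE _]] := wedge_det k n.
apply/eqP => /lfunP/(_ (wedge (std_vtuple k n))); rewrite id_lfunE zero_lfunE.
move=> /(congr1 D); rewrite DE linear0.
by rewrite std_vtuple_mx det1 => /eqP; rewrite oner_eq0.
Qed.

End GLPart.

(** * Coefficient modules of the double complex *)

Section DoubleComplex.
Variables (k : finFieldType) (n' : nat).
Local Notation n := n'.+1.
Local Notation std := (vect_std k n).
Local Notation End := (@free_hom k n std).
Local Notation gT := {'GL_n[k]}.
Local Notation L := (exterior_functor k n n).
Implicit Types F G : vfunctor k n.

(** The GL_n-module Hom_k(k[GL_n] (x) F(k^n), Lambda^n(k^n)), written as a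
coinduced module: the function m stands for the map sending [rho x] (x) s to
Lambda^n(rho x) (m x s), so that equivariant maps are the constant functions. *)
Definition coef F : gmodule gT k := coind gT 'Hom(F std, L std).

(** The linear map represented by m, extended by zero to the summands
indexed by singular endomorphisms. *)
Definition ev_fun F (m : coef F) (phi : free_functor F std) : L std :=
  \sum_(x : gT) fmap L (rho x) ((m : {ffun gT -> 'Hom(F std, L std)}) x (phi (rho x))).

Lemma ev_fun_linear F (m : coef F) : linear (ev_fun m).
Proof.
move=> a x y; rewrite /ev_fun scaler_sumr -big_split /=.
by apply: eq_bigr => f _; rewrite !ffunE !linearP.
Qed.
HB.instance Definition _ F m := GRing.isLinear.Build k (free_functor F std) (L std) _
  (@ev_fun F m) (@ev_fun_linear F m).

Definition ev F (m : coef F) : 'Hom(free_functor F std, L std) := linfun (ev_fun m).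

Lemma ev_rho F (m : coef F) x s :
  ev m (free_single (rho x) s) = fmap L (rho x) ((m : {ffun gT -> 'Hom(F std, L std)}) x s).
Proof.
rewrite lfunE /= /ev_fun (bigD1 x) //= ffunE eqxx big1 ?addr0 // => y /negPf yx.
by rewrite ffunE (inj_eq (@rho_inj k n')) yx !linear0.
Qed.

Lemma ev_singular F (m : coef F) phi :
  supported (singular k n') phi -> ev m phi = 0.
Proof.
move=> phiS; rewrite lfunE /= /ev_fun big1 // => x _.
by rewrite phiS ?rho_nonsingular // !linear0.
Qed.

Lemma supported_single F (f : 'End(std)) (s : F std) (X : {set End}) :
  (f : End) \in X -> supported X (free_single f s : free_functor F std).
Proof.
by move=> fX h hX; rewrite ffunE; case: eqP => // hf; move: hX; rewrite hf fX.
Qed.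

Lemma eq_on_single F (Z : vectType k) (a b : 'Hom(free_functor F std, Z)) :
  (forall (f : 'End(std)) s, a (free_single f s) = b (free_single f s)) -> a = b.
Proof.
move=> ab; apply/lfunP => phi; rewrite (free_single_sum phi) !linear_sum.
by apply: eq_bigr => f _; apply: ab.
Qed.

Lemma ev_unique F (m : coef F) (a : 'Hom(free_functor F std, L std)) :
  (forall phi, supported (singular k n') phi -> a phi = 0) ->
  (forall x s, a (free_single (rho x) s) = fmap L (rho x) ((m : {ffun gT -> 'Hom(F std, L std)}) x s)) ->
  ev m = a.
Proof.
move=> aS aE; apply: eq_on_single => f s; have [fS|/nonsingular_rho[x ->]] := boolP ((f : End) \in singular k n').
  by rewrite ev_singular ?aS //; apply: supported_single.
by rewrite ev_rho aE.
Qed.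

Lemma fmap_rhoK F x s : fmap F (rho x^-1%g) (fmap F (rho x) s) = s.
Proof. by rewrite -fmap_compE -rhoM mulgV rho1 fmap1E. Qed.

Lemma fmap_rhoVK F x s : fmap F (rho x) (fmap F (rho x^-1%g) s) = s.
Proof. by rewrite -fmap_compE -rhoM mulVg rho1 fmap1E. Qed.

Lemma ev_inj F : injective (@ev F).
Proof.
move=> m m' mm'; apply/ffunP => x; apply/lfunP => s.
by apply: (can_inj (@fmap_rhoK L x)); rewrite -!ev_rho mm'.
Qed.

HB.instance Definition _ F (V : vect_le k n) (f : 'Hom(std, V)) :=
  GRing.isLinear.Build k (F std) (free_functor F V) _ (free_single f)
    (@free_single_linear k n F V f).

Definition single F (f : 'End(std)) : 'Hom(F std, free_functor F std) :=
  linfun (free_single f : F std -> free_functor F std).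

Lemma singleE F f (s : F std) : single F f s = free_single f s.
Proof. by rewrite lfunE. Qed.

Lemma ev_surj F (a : 'Hom(free_functor F std, L std)) :
  (forall phi, supported (singular k n') phi -> a phi = 0) -> exists m, ev m = a.
Proof.
move=> aS; pose m : {ffun gT -> 'Hom(F std, L std)} :=
  [ffun x => (fmap L (rho x^-1%g) \o a \o single F (rho x))%VF].
exists (m : coef F); apply: ev_unique => // x s.
by rewrite ffunE !comp_lfunE singleE fmap_rhoVK.
Qed.

(** The translation action on m is conjugation on the linear map it stands for. *)
Lemma ev_fmap_rho F (m : coef F) x phi :
  ev m (fmap (free_functor F) (rho x) phi) = fmap L (rho x) (ev (Defs.gact (coef F) x m) phi).
Proof.
pose a := (fmap L (rho x^-1%g) \o ev m \o fmap (free_functor F) (rho x))%VF.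
have rhoS phi0 : supported (singular k n') phi0 ->
    supported (singular k n') (fmap (free_functor F) (rho x) phi0).
  move=> phi0S h hS; rewrite /= free_mapE big1 // => f /eqP fh; apply: phi0S.
  apply: contra hS; rewrite -fh !inE end_mx_comp det_mulmx => /eqP ->.
  by rewrite mul0r.
suff -> : ev (Defs.gact (coef F) x m) = a by rewrite !comp_lfunE fmap_rhoVK.
apply: ev_unique => [psi psiS|y s]; rewrite !comp_lfunE.
  by rewrite ev_singular ?linear0 //; apply: rhoS.
by rewrite fmap_free_single -rhoM ev_rho ffunE rhoM fmap_compE fmap_rhoK.
Qed.

Lemma ev_linear F : linear (@ev F).
Proof.
move=> a m m'; apply/lfunP => phi; rewrite add_lfunE scale_lfunE !lfunE /= /ev_fun.
rewrite scaler_sumr -big_split /=; apply: eq_bigr => x _.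
by rewrite !ffunE add_lfunE scale_lfunE linearP.
Qed.

HB.instance Definition _ F := GRing.isLinear.Build k (coef F)
  'Hom(free_functor F std, L std) _ (@ev F) (@ev_linear F).

Section Pullback.
Variables (F G : vfunctor k n) (a : nattrans (free_functor F) (free_functor G)).

(** Precomposition with a, in terms of the functions standing for linear maps.
By equivariance the value at x is read off on the summand of the identity, after
translating m by x. *)
Definition pull_fun (m : coef G) : coef F :=
  [ffun x => (ev (Defs.gact (coef G) x m) \o a std \o single F \1%VF)%VF].

(** Both sides vanish on singular summands: a preserves the elements supported on
the right ideal of singular endomorphisms. *)
Lemma ev_pull m : ev (pull_fun m) = (ev m \o a std)%VF.
Proof.
apply: ev_unique => [phi phiS|x s]; rewrite comp_lfunE.
  by rewrite ev_singular //; apply: nt_supported => //; apply: singular_ideal.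
by rewrite free_singleE (nt_naturalE a) ev_fmap_rho ffunE !comp_lfunE singleE.
Qed.

Lemma pull_linear : linear pull_fun.
Proof.
move=> c m m'; apply: ev_inj; rewrite ev_linear !ev_pull ev_linear.
by rewrite comp_lfunDl -comp_lfunZl.
Qed.
HB.instance Definition _ := GRing.isLinear.Build k (coef G) (coef F) _ pull_fun pull_linear.

Definition pull : {linear coef G -> coef F} := pull_fun : {linear _ -> _}.

Lemma pull_gact x m : pull (Defs.gact (coef G) x m) = Defs.gact (coef F) x (pull m).
Proof. by apply/ffunP => y; rewrite !ffunE /= -coind_actM. Qed.
End Pullback.

Definition res_coef q : gmodule gT k := coef (syzygy L q).
Definition res_pull q : {linear res_coef q -> res_coef q.+1} := pull (std_res_diff L q).

Lemma ev_res_pull q m : ev (res_pull q m) = (ev m \o std_res_diff L q std)%VF.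
Proof. exact: ev_pull. Qed.

Lemma std_res_diffK q : (std_res_diff L q std \o std_res_diff L q.+1 std)%VF = 0.
Proof.
apply/lfunP => x; rewrite comp_lfunE zero_lfunE; apply/eqP.
by rewrite -memv_ker -(std_res_exact L q std) memv_img ?memvf.
Qed.

Lemma res_pullK q m : res_pull q.+1 (res_pull q m) = 0.
Proof.
by apply: ev_inj; rewrite !ev_res_pull -comp_lfunA std_res_diffK comp_lfun0r linear0.
Qed.

Definition nonsingular_part_fun F (phi : free_functor F std) : free_functor F std :=
  [ffun f : End => if f \in singular k n' then 0 else phi f].

Lemma nonsingular_part_linear F : linear (@nonsingular_part_fun F).
Proof.
by move=> a x y; apply/ffunP => f; rewrite !ffunE; case: ifP; rewrite ?scaler0 ?addr0.
Qed.
HB.instance Definition _ F := GRing.isLinear.Build k (free_functor F std)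
  (free_functor F std) _ (@nonsingular_part_fun F) (@nonsingular_part_linear F).

Definition singular_part F : {vspace free_functor F std} :=
  lker (linfun (@nonsingular_part_fun F)).

Lemma singular_partP F (phi : free_functor F std) :
  reflect (supported (singular k n') phi) (phi \in singular_part F).
Proof.
rewrite memv_ker lfunE /=; apply: (iffP eqP) => [phi0 f /negPf fS|phiS].
  by have := congr1 (fun psi : free_functor F std => psi f) phi0; rewrite !ffunE fS.
by apply/ffunP => f; rewrite !ffunE; case: ifP => // /negbT/phiS.
Qed.

(** Exactness of Hom_k(Q, Lambda^n(k^n)), where Q is the standard resolution
modulo its singular part. The map standing for m extends along the differential
as soon as it kills every x with singular boundary. By acyclicity of the singular
part, such an x is the sum of a singular y, which is killed, and of a cycle, which
is a boundary and hence is killed as well. *)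
Lemma res_pull_exact q (m : res_coef q.+1) :
  res_pull q.+1 m = 0 -> exists m', m = res_pull q m'.
Proof.
move=> m0.
have md : (ev m \o std_res_diff L q.+1 std)%VF = 0.
  by rewrite -ev_res_pull m0 linear0.
have [x xS|a [aE aS]] := lfun_extend (a := std_res_diff L q std)
    (U := singular_part (syzygy L q)) (f := ev m).
  have x0 : free_aug (syzygy L q) std (std_res_diff L q std x) = 0.
    by apply/eqP; rewrite -memv_ker -limg_std_res_diff memv_img ?memvf.
  have [y yS yx] := std_res_acyclic (@singular_ideal k n')
    (@exterior_singular k n') (singular_partP _ xS) x0.
  have : x - y \in lker (std_res_diff L q std).
    by rewrite memv_ker linearB /= yx subrr.
  rewrite -(std_res_exact L q std) => /memv_imgP[w _ xyw].
  rewrite -[x](subrK y) linearD /= [ev m y]ev_singular // addr0 xyw.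
  by rewrite -[LHS]comp_lfunE md zero_lfunE.
have [m' m'E] : exists m', ev m' = a.
  by apply: ev_surj => phi /singular_partP; apply: aS.
exists m'; apply: ev_inj; rewrite ev_res_pull m'E; apply/lfunP => x.
by rewrite comp_lfunE aE.
Qed.

Definition scalar_coef (c : k^o) : res_coef 0 := [ffun _ => c *: \1%VF].

Lemma ev_scalar c : ev (scalar_coef c) = c *: free_aug L std.
Proof.
apply: ev_unique => [phi phiS|x s]; rewrite scale_lfunE.
  rewrite [free_aug _ _ _]lfunE /= /free_aug_fun big1 ?scaler0 // => f _.
  have [fS|fS] := boolP (f \in singular k n'); last by rewrite phiS // linear0.
  by rewrite exterior_singular // zero_lfunE.
have -> : (scalar_coef c : {ffun gT -> 'End(L std)}) x = c *: \1%VF by exact: ffunE.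
by rewrite free_aug_single scale_lfunE id_lfunE linearZ.
Qed.

Lemma scalar_coef_inj : injective scalar_coef.
Proof.
move=> c d cd; have := etrans (esym (ev_scalar c)) (etrans (congr1 (@ev _) cd) (ev_scalar d)).
move=> /eqP; rewrite -subr_eq0 -scalerBl scaler_eq0 subr_eq0.
case/orP=> [/eqP //|/eqP aug0].
case/negP: (exterior_id_neq0 k n'); apply/eqP/lfunP => x.
have := free_aug_single (\1%VF : 'End(std)) (x : L std).
by rewrite aug0 zero_lfunE fmap1E id_lfunE zero_lfunE => <-.
Qed.

Lemma scalar_coef_linear : linear scalar_coef.
Proof.
move=> a c d; apply: ev_inj; rewrite ev_linear.
apply: etrans (ev_scalar _) _; rewrite scalerDl -scalerA.
by congr (_ *: _ + _); apply/esym/ev_scalar.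
Qed.
HB.instance Definition _ := GRing.isLinear.Build k k^o (res_coef 0) _ scalar_coef scalar_coef_linear.

(** A map on Q_0 that kills boundaries factors through the augmentation, and the
endomorphisms of the line Lambda^n(k^n) are the scalars. *)
Lemma res_pull0_ker (m : res_coef 0) :
  res_pull 0 m = 0 <-> exists c, m = scalar_coef c.
Proof.
split=> [m0|[c ->]].
  have kaug : (lker (free_aug L std) <= lker (ev m))%VS.
    rewrite -(limg_std_res_diff L 0); apply/subvP => _ /memv_imgP[x _ ->].
    by rewrite memv_ker -comp_lfunE -ev_res_pull m0 linear0 zero_lfunE.
  have [c cE] := exterior_scalar (ev m \o (free_aug L std)^-1)%VF.
  exists c; apply: ev_inj; rewrite ev_scalar; apply/lfunP => x.
  rewrite -(lfun_factor x kaug) -comp_lfunE cE !scale_lfunE.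
  by rewrite id_lfunE.
apply: ev_inj; rewrite ev_res_pull ev_scalar linear0 -comp_lfunZl.
apply/lfunP => x; rewrite scale_lfunE comp_lfunE zero_lfunE.
have : std_res_diff L 0 std x \in lker (free_aug L std).
  by rewrite -(limg_std_res_diff L 0) memv_img ?memvf.
by rewrite memv_ker => /eqP ->; rewrite scaler0.
Qed.

End DoubleComplex.

(** * The double complex *)

Section Assembly.
Variables (k : finFieldType) (n' : nat).
Local Notation n := n'.+1.
Local Notation std := (vect_std k n).
Local Notation gT := {'GL_n[k]}.
Local Notation L := (exterior_functor k n n).
Local Notation A := (hom_complex (std_resolution L) L).
Local Notation B := (group_complex (trivial_gmodule gT k)).

Definition bicochain p q : lmodType k := group_cochain (res_coef k n' q) p.

Definition bicochain_v p q : {linear bicochain p q -> bicochain p.+1 q} :=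
  codiff (group_complex (res_coef k n' q)) p.

Definition bicochain_h p q : {linear bicochain p q -> bicochain p q.+1} :=
  @cochain_map gT k (res_coef k n' q) (res_coef k n' q.+1) (@res_pull k n' q) p : {linear _ -> _}.

Lemma bicochain_hE p q x g : bicochain_h p q x g = res_pull k n' q (x g).
Proof. by rewrite ffunE. Qed.

Lemma bicochain_h_exact p q x : bicochain_h p q.+1 x = 0 ->
  exists y, x = bicochain_h p q y.
Proof.
move=> x0; have /choice[y yE] g : exists m, x g = res_pull k n' q m.
  by apply: res_pull_exact; rewrite -bicochain_hE x0 ffunE.
by exists [ffun g => y g]; apply/ffunP => g; rewrite bicochain_hE ffunE.
Qed.

Definition scalar_cochain p : {linear B p -> bicochain p 0} :=
  @cochain_map gT k (trivial_gmodule gT k) (res_coef k n' 0) (@scalar_coef k n') p : {linear _ -> _}.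

Lemma scalar_cochainE p (b : B p) g : scalar_cochain p b g = @scalar_coef k n' (b g).
Proof. exact: ffunE. Qed.

Lemma scalar_cochain_ker p x : bicochain_h p 0 x = 0 <-> exists b, x = scalar_cochain p b.
Proof.
split=> [x0|[b ->]].
  have /choice[b bE] g : exists c, x g = @scalar_coef k n' c.
    by apply/res_pull0_ker; rewrite -bicochain_hE x0 ffunE.
  exists [ffun g => b g]; apply/ffunP => g.
  by rewrite bE; apply/esym/(etrans (scalar_cochainE _ _)); rewrite ffunE.
apply/ffunP => g; rewrite bicochain_hE [RHS]ffunE; apply/res_pull0_ker.
by exists (b g); apply: scalar_cochainE.
Qed.

Lemma scalar_cochain_inj p : injective (scalar_cochain p).
Proof.
move=> b b' bb; apply/ffunP => g; apply: scalar_coef_inj.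
by apply: etrans (esym (scalar_cochainE b g)) _; rewrite bb; apply: scalar_cochainE.
Qed.

Definition hom_bicochain_fun q (a : A q) : bicochain 0 q :=
  [ffun _ => [ffun _ => (nat_hom_val a \o single (syzygy L q) \1%VF)%VF]].

Lemma hom_bicochain_linear q : linear (@hom_bicochain_fun q).
Proof.
move=> c a b; apply/ffunP => g; apply/ffunP => x; rewrite !ffunE /=.
by rewrite comp_lfunDl -comp_lfunZl.
Qed.
HB.instance Definition _ q := GRing.isLinear.Build k (A q) (bicochain 0 q) _
  (@hom_bicochain_fun q) (@hom_bicochain_linear q).
Definition hom_bicochain q : {linear A q -> bicochain 0 q} := @hom_bicochain_fun q : {linear _ -> _}.

(** A natural transformation to Lambda^n vanishes on singular summands by
naturality, so it is recovered from its restriction to the summand of the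
identity. *)
Lemma ev_hom_bicochain q (a : A q) g : ev (hom_bicochain q a g) = nat_hom_val a.
Proof.
rewrite -nattrans_of_std; apply: ev_unique => [phi phiS|x s].
  rewrite (free_single_sum phi) linear_sum big1 //= => f _.
  have [fS|fS] := boolP (f \in singular k n'); last by rewrite phiS // free_single0 linear0.
  by rewrite free_singleE (nt_naturalE (nattrans_of a)) exterior_singular // zero_lfunE.
rewrite free_singleE (nt_naturalE (nattrans_of a)) !ffunE comp_lfunE singleE.
by rewrite nattrans_of_std.
Qed.

Lemma hom_bicochain_inj q : injective (hom_bicochain q).
Proof.
move=> a b ab; apply: val_inj => /=.
by rewrite -(ev_hom_bicochain a [ffun _ => 1%g]) ab ev_hom_bicochain.
Qed.

Lemma hom_bicochain_codiff q a :
  hom_bicochain q.+1 (codiff A q a) = bicochain_h 0 q (hom_bicochain q a).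
Proof.
apply/ffunP => g; apply: ev_inj; rewrite bicochain_hE ev_res_pull.
by rewrite !ev_hom_bicochain /= nattrans_of_std.
Qed.

(** Invariants of a coinduced module are the constant functions, and every linear
map F(k^n) -> Lambda^n(k^n) extends to the free functor on F. *)
Lemma hom_bicochain_ker q x : bicochain_v 0 q x = 0 <-> exists a, x = hom_bicochain q a.
Proof.
split=> [/coind_codiff0_ker[u ->]|[a ->]]; last by apply/coind_codiff0_ker; eexists.
exists (nat_hom_of (free_trans u)); apply/ffunP => g; apply/ffunP => y.
rewrite !ffunE; apply/lfunP => s.
rewrite comp_lfunE singleE; apply/esym/(etrans (free_trans_app_single _ _ _)).
exact: fmap1E.
Qed.

Lemma group_cohomology_Ext_sq m : sq_iso (cohomology_sq B m) (cohomology_sq A m).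
Proof.
apply: (@balancing k bicochain bicochain_v bicochain_h _ _ _ _ _ A B hom_bicochain scalar_cochain).
- by move=> p q x; exact: (codiffK (c := group_complex (res_coef k n' q))).
- by move=> p q x; apply/ffunP => g; rewrite !bicochain_hE res_pullK ffunE.
- by move=> p q x; apply: cochain_map_codiff => g m0; apply: pull_gact.
- by move=> p q x; apply: coind_codiff_exact.
- exact: bicochain_h_exact.
- exact: hom_bicochain_inj.
- exact: scalar_cochain_inj.
- exact: hom_bicochain_codiff.
- move=> p b; apply/esym/cochain_map_codiff => g c.
  by apply/ffunP => x; rewrite !ffunE.
- exact: hom_bicochain_ker.
- exact: scalar_cochain_ker.
Qed.
End Assembly.

Theorem corollary1p7 (k : finFieldType) (n : nat) (n_gt0 : (0 < n)%N) :
  exists phi : forall i : nat,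
      {linear group_cohomology (trivial_gmodule {'GL_n[k]} k) i
              -> Ext i (exterior_functor k n n) (exterior_functor k n n)},
    forall i : nat, bijective (phi i).
Proof.
case: n n_gt0 => // n' _.
have /all_sig[phi phiP] i := cid (cohomology_sq_iso (@group_cohomology_Ext_sq k n' i)).
by exists phi.
Qed.
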